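(* Let $\widetilde{X}_n = X_n + P_n$, where $X_n$, $P_n$, $\mu_X$, $a$, $b$ satisfy the standing assumptions given in the context, with $P_n$ of rank $r=1$ and sole non-zero eigenvalue $\theta$. Suppose that $$\frac1\theta\notin(G_{\mu_X}(a^-),G_{\mu_X}(b^+))\quad\text{and}\quad\begin{cases}G_{\mu_X}'(b^+)=-\infty & \text{if }\theta>0,\\ G_{\mu_X}'(a^-)=-\infty & \text{if }\theta<0.\end{cases}$$ For each $n$, let $\widetilde{u}$ be a unit-norm eigenvector of $\widetilde{X}_n$ associated with its largest eigenvalue if $\theta>0$, or with its smallest eigenvalue if $\theta<0$. Then, almost surely, $$\langle\widetilde{u},\ker(\theta I_n-P_n)\rangle\longrightarrow0\quad\text{as }n\to\infty.$$
   Context: Eigenvalues of an $n\times n$ Hermitian matrix $M$ are ordered as $\lambda_1(M)\ge\cdots\ge\lambda_n(M)$. For a function $f$ and $c\in\mathbb{R}$, $f(c^+)=\lim_{z\downarrow c}f(z)$ and $f(c^-)=\lim_{z\uparrow c}f(z)$. For a subspace $F$ of a Euclidean (or Hermitian) space $E$ and $x\in E$, $\langle x,F\rangle$ denotes the norm of the orthogonal projection of $x$ onto $F$. Standing assumptions. All random objects are defined on a common probability space. For each $n$, $X_n$ is an $n\times n$ real symmetric (or complex Hermitian) random matrix with empirical eigenvalue distribution $\mu_{X_n}=\frac1n\sum_{j=1}^n\delta_{\lambda_j(X_n)}$. Almost surely, $\mu_{X_n}$ converges weakly as $n\to\infty$ to a non-random compactly supported probability measure $\mu_X$ on $\mathbb{R}$.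 Let $a$ and $b$ be the infimum and supremum of the support of $\mu_X$; it is assumed that $\lambda_n(X_n)\to a$ and $\lambda_1(X_n)\to b$ almost surely. Let $\theta$ be a deterministic non-zero real number independent of $n$. For each $n$, $P_n$ is an $n\times n$ symmetric (or Hermitian) random matrix of rank $1$ whose only non-zero eigenvalue is $\theta$. $X_n$ and $P_n$ are independent, and either $X_n$ or $P_n$ is orthogonally invariant (in the symmetric case) or unitarily invariant (in the Hermitian case), i.e. its distribution is invariant under conjugation by every orthogonal (respectively unitary) matrix. The Cauchy transform of $\mu_X$ is $G_{\mu_X}(z)=\int\frac{1}{z-t}\,d\mu_X(t)$ for $z\notin\operatorname{supp}\mu_X$; the limits $G_{\mu_X}(a^-)\in[-\infty,0)$ and $G_{\mu_X}(b^+)\in(0,+\infty]$ exist. *)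

(* Defs.v *)
From HB Require Import structures.
From mathcomp Require Import all_boot all_order all_algebra.
From mathcomp Require Import complex.
From mathcomp Require Import all_classical all_reals all_analysis.

Set Implicit Arguments.
Unset Strict Implicit.
Unset Printing Implicit Defensive.

Import Order.TTheory GRing.Theory Num.Theory.
Import numFieldNormedType.Exports.

Local Open Scope classical_set_scope.
Local Open Scope ring_scope.
Local Open Scope sesquilinear_scope.
Local Open Scope complex_scope.

(* MathComp vectors are row vectors, on which matrices act on the right. For a
   Hermitian M and a real l, u *m M = l *: u holds iff the column vector u^t*
   satisfies M *m u^t* = l *: u^t*, and u |-> u^t* is a (conjugate-linear)
   isometry, so the row convention does not change any norm of a projection. *)

(* Both cases live over R[i]: in the real symmetric case all matrices and
   vectors are required to have real entries, so that Hermitian means symmetric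
   and unitary means orthogonal. *)
Inductive symmetry_class := RealSymmetric | ComplexHermitian.

Definition over_scalars (R : realType) (s : symmetry_class) (m n : nat)
    (M : 'M[R[i]]_(m, n)) : Prop :=
  match s with
  | RealSymmetric => M \is a realmx
  | ComplexHermitian => True
  end.

Definition self_adjoint (R : realType) (s : symmetry_class) (n : nat)
    (M : 'M[R[i]]_n) : Prop :=
  M \is hermsymmx /\ over_scalars s M.

(* The Borel sigma-algebra of the space of complex n x n matrices, generated by
   the real and imaginary parts of the entries. *)
Definition mx_cylinder (R : realType) (n : nat) : set (set 'M[R[i]]_n) :=
  [set B | exists (i j : 'I_n) (A : set R), measurable A /\
     (B = [set M : 'M[R[i]]_n | A (complex.Re (M i j))] \/
      B = [set M : 'M[R[i]]_n | A (complex.Im (M i j))])].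

Definition mx_measurable (R : realType) (n : nat) : set (set 'M[R[i]]_n) :=
  <<s @mx_cylinder R n >>.

Section random_matrices.
Context (d : measure_display) (T : measurableType d) (R : realType).
Variable Pr : probability T R.

Definition random_matrix (n : nat) (X : T -> 'M[R[i]]_n) : Prop :=
  forall B, mx_measurable B -> measurable (X @^-1` B).

Definition independent_matrices (n : nat) (X Y : T -> 'M[R[i]]_n) : Prop :=
  forall A B, mx_measurable A -> mx_measurable B ->
    Pr ((X @^-1` A) `&` (Y @^-1` B)) = (Pr (X @^-1` A) * Pr (Y @^-1` B))%E.

Definition conj_invariant (s : symmetry_class) (n : nat)
    (X : T -> 'M[R[i]]_n) : Prop :=
  forall U : 'M[R[i]]_n, U \is unitarymx -> over_scalars s U ->
  forall B, mx_measurable B ->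
    Pr ((fun w => U *m X w *m U ^t*) @^-1` B) = Pr (X @^-1` B).

End random_matrices.

(* The eigenvalues with multiplicity in nonincreasing order, for Hermitian M
   (spectral_diag M then has real entries). *)
Definition eigenvalues (R : realType) (n : nat) (M : 'M[R[i]]_n) : seq R :=
  sort >=%R [seq complex.Re (spectral_diag M 0 j) | j : 'I_n].

(* Numbered from 0: the k-th largest eigenvalue is eigval M k.-1. *)
Definition eigval (R : realType) (n : nat) (M : 'M[R[i]]_n) (k : nat) : R :=
  (eigenvalues M)`_k.

Definition lambda_max (R : realType) (n : nat) (M : 'M[R[i]]_n.+1) : R :=
  eigval M 0.

Definition lambda_min (R : realType) (n : nat) (M : 'M[R[i]]_n.+1) : R :=
  eigval M n.

Definition empirical_measure (R : realType) (n : nat) (M : 'M[R[i]]_n) :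
    {measure set (measurableTypeR R) -> \bar R} :=
  mscale ((n%:R : R)^-1)%:nng (msum (fun k => \d_(eigval M k : measurableTypeR R)) n).

Definition weak_cvg (R : realType)
    (mu_ : nat -> {measure set (measurableTypeR R) -> \bar R})
    (mu : {measure set (measurableTypeR R) -> \bar R}) : Prop :=
  forall f : R -> R, continuous f -> bounded_fun f ->
    (\int[mu_ n]_x f x) @[n --> \oo] --> \int[mu]_x f x.

Definition msupport (R : realType)
    (mu : {measure set (measurableTypeR R) -> \bar R}) : set R :=
  [set x | forall U : set R, open U -> U x -> (0 < mu U)%E].

(* Only the values at real z outside the support of mu are meaningful. *)
Definition cauchy_transform (R : realType)
    (mu : {measure set (measurableTypeR R) -> \bar R}) (z : R) : R :=
  \int[mu]_t (z - t)^-1.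

(* f(c^+) and f(c^-), with values in the extended reals; if the limit does not
   exist, lim is the default value 0. *)
Definition right_lim (R : realType) (f : R -> R) (c : R) : \bar R :=
  lim ((f z)%:E @[z --> c^'+]).

Definition left_lim (R : realType) (f : R -> R) (c : R) : \bar R :=
  lim ((f z)%:E @[z --> c^'-]).

Definition vnorm (R : realType) (n : nat) (u : 'rV[R[i]]_n) : R :=
  Num.sqrt (complex.Re (dotmx u u)).

(* The norm of the orthogonal projection of u onto the row space of F. *)
Definition proj_norm (R : realType) (m n : nat) (u : 'rV[R[i]]_n)
    (F : 'M[R[i]]_(m, n)) : R :=
  vnorm (u *m proj_ortho F).

(* Main.v *)
Require Import Defs.
From HB Require Import structures.
From mathcomp Require Import all_boot all_order all_algebra.
From mathcomp Require Import complex.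
From mathcomp Require Import all_classical all_reals all_analysis.
From mathcomp Require Import measurable_realfun.
From mathcomp Require Import ring lra.

Set Implicit Arguments.
Unset Strict Implicit.
Unset Printing Implicit Defensive.

Import Order.TTheory GRing.Theory Num.Theory.
Import numFieldNormedType.Exports.

Local Open Scope classical_set_scope.
Local Open Scope ring_scope.
Local Open Scope sesquilinear_scope.
Local Open Scope complex_scope.

(** Suppose [theta > 0]; the other sign follows by reflecting the real line. Write
    [P = theta v'v] with a unit row vector [v] and its adjoint [v'], let [u] be the top
    eigenvector of [X + P], [l] its eigenvalue and [al] the inner product of [u] and
    [v], whose modulus is the norm of the projection in the theorem. Let [w_j] be the
    mass of the spectral measure of [X] at [v] at the eigenvalue [x_j]. If [al] is
    nonzero, the eigenvector equation gives (lemma [secular]) that the sum of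
    [w_j / (l - x_j)] is [theta^-1] and that the sum of [w_j / (l - x_j) ^+ 2] is at
    most the inverse of the product of [theta ^+ 2] and the squared modulus of [al].

    If the spectral measures at [v] converge to [mu], the first equation forces [l]
    down to [b], because [G < theta^-1] beyond [b]; the second sum is then at least a
    difference quotient of [G] near [b], and these are unbounded as [G'] tends to
    minus infinity there. So [al] tends to 0 ([subcritical_core]).

    What remains is that the spectral measures at [v] and the empirical measures of
    the eigenvalues have the same limit almost surely. By geometric series it is
    enough to compare moments ([stieltjes_transfer]), that is, to show that
    [S = tr (A P)] tends to 0 almost surely for [A] the traceless part of a power of
    [X]. The law of [S] does not change when [P] is rotated in a coordinate plane,
    whichever of [X] and [P] is invariant ([rot_invariance]); differentiating gives an integration by parts formula ([stein_rot]) for the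
    generators of the rotations. The sum of the squares of these generators is a
    Casimir operator ([casimir]), for which [S] is close to an eigenvector with
    eigenvalue of the order of the dimension, whereas the gradient of [S] is bounded
    independently of the dimension ([grad_bound]). Hence the fourth moment of [S] is
    of the order of the inverse square of the dimension ([fourth_moment]), which is
    summable, and almost sure convergence follows ([ae_cvg0]). The rotations are
    real, so they belong to the invariance group in both symmetry classes, which are
    therefore treated together. *)

(** * Hermitian matrices and their spectral weights *)

Section spectral.
Variable R : realType.
Notation C := R[i].

(** The squared modulus, kept in [R] because the order of [R[i]] is partial. *)
Definition sqmod (z : C) : R := complex.Re z ^+ 2 + complex.Im z ^+ 2.

Definition norm2 (n : nat) (x : 'rV[C]_n) : R := \sum_i sqmod (x 0 i).

Lemma sqmod_ge0 z : 0 <= sqmod z.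
Proof. by rewrite addr_ge0 ?sqr_ge0. Qed.

Lemma mul_conjE (z : C) : z * Num.conj z = (sqmod z)%:C.
Proof. by rewrite -normCK /sqmod add_Re2_Im2. Qed.

Lemma sqmodM z1 z2 : sqmod (z1 * z2) = sqmod z1 * sqmod z2.
Proof. by case: z1 => a b; case: z2 => c d; rewrite /sqmod /=; ring. Qed.

Lemma sqmodR (r : R) : sqmod r%:C = r ^+ 2.
Proof. by rewrite /sqmod /= expr0n addr0. Qed.

Lemma sqmod_eq0 z : sqmod z = 0 -> z = 0.
Proof.
case: z => a b /eqP; rewrite /sqmod /= paddr_eq0 ?sqr_ge0 // !sqrf_eq0.
by case/andP => /eqP -> /eqP ->.
Qed.

Lemma ReD (z1 z2 : C) : complex.Re (z1 + z2) = complex.Re z1 + complex.Re z2.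
Proof. by case: z1; case: z2. Qed.

Lemma ReZ (r : R) (z : C) : complex.Re (r%:C * z) = r * complex.Re z.
Proof. by case: z => a b /=; rewrite mul0r subr0. Qed.

Lemma ReN (z : C) : complex.Re (- z) = - complex.Re z.
Proof. by case: z. Qed.

Lemma Re_sum (I : Type) (r : seq I) (P : pred I) (F : I -> C) :
  complex.Re (\sum_(i <- r | P i) F i) = \sum_(i <- r | P i) complex.Re (F i).
Proof. exact: (big_morph _ ReD). Qed.

Lemma norm2_ge0 n (x : 'rV[C]_n) : 0 <= norm2 x.
Proof. by rewrite sumr_ge0 // => i _; exact: sqmod_ge0. Qed.

Lemma norm2E n (x : 'rV[C]_n) : (x *m x^t*) 0 0 = (norm2 x)%:C.
Proof.
rewrite mxE rmorph_sum; apply: eq_bigr => i _.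
by rewrite !mxE mul_conjE.
Qed.

Lemma vnormE n (x : 'rV[C]_n) : vnorm x = Num.sqrt (norm2 x).
Proof. by rewrite /vnorm dotmxE norm2E. Qed.

Lemma hermP n (M : 'M[C]_n) : M \is hermsymmx -> M^t* = M.
Proof.
by move=> /is_hermitianmxP; rewrite expr0 scale1r => h; rewrite -h.
Qed.

Lemma herm_intro n (M : 'M[C]_n) : M^t* = M -> M \is hermsymmx.
Proof. by move=> h; apply/is_hermitianmxP; rewrite expr0 scale1r. Qed.

Definition ev n (M : 'M[C]_n) (j : 'I_n) : R := complex.Re (spectral_diag M 0 j).

(** The measure with masses [wt M x] at the points [ev M] is the spectral measure
    of [M] at [x]: its moments are the quadratic forms of the powers of [M]. *)
Definition wt n (M : 'M[C]_n) (x : 'rV[C]_n) (j : 'I_n) : R :=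
  sqmod ((x *m (spectralmx M)^t*) 0 j).

Lemma wt_ge0 n (M : 'M[C]_n) x j : 0 <= wt M x j.
Proof. exact: sqmod_ge0. Qed.

Lemma evE n (M : 'M[C]_n) j : M \is hermsymmx -> spectral_diag M 0 j = (ev M j)%:C.
Proof.
move=> /hermitian_spectral_diag_real /mxOverP h.
by rewrite /ev RRe_real.
Qed.

Lemma spectralE n (M : 'M[C]_n) : M \is hermsymmx ->
  M = (spectralmx M)^t* *m diag_mx (spectral_diag M) *m spectralmx M.
Proof.
move=> /hermitian_normalmx /orthomx_spectralP {1}->.
by rewrite invmx_unitary // spectral_unitarymx.
Qed.

Lemma spectral_mulV n (M : 'M[C]_n) : (spectralmx M)^t* *m spectralmx M = 1%:M.
Proof. by rewrite -invmx_unitary ?mulVmx ?spectral_unit ?spectral_unitarymx. Qed.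

Lemma spectral_mul n (M : 'M[C]_n) : spectralmx M *m (spectralmx M)^t* = 1%:M.
Proof. exact/unitarymxP/spectral_unitarymx. Qed.

Lemma sum_wt n (M : 'M[C]_n) x : \sum_j wt M x j = norm2 x.
Proof.
apply: complexI; rewrite -(norm2E x).
have -> : x *m x^t* = (x *m (spectralmx M)^t*) *m (x *m (spectralmx M)^t*)^t*.
  by rewrite trmx_mul map_mxM trmxCK mulmxA -[x *m _ *m _]mulmxA spectral_mulV mulmx1.
by rewrite norm2E.
Qed.

Lemma spectralX n (M : 'M[C]_n.+1) k : M \is hermsymmx ->
  M ^+ k = (spectralmx M)^t* *m diag_mx (\row_j (ev M j ^+ k)%:C) *m spectralmx M.
Proof.
move=> hM; elim: k => [|k IH].
  rewrite expr0 (_ : diag_mx _ = 1%:M) ?mulmx1 ?spectral_mulV //.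
  by apply/matrixP => i j; rewrite !mxE expr0.
have VW := spectral_mul M.
rewrite exprS IH {1}(spectralE hM) -mulmxE.
move: (spectralmx M) VW => V; move: (V^t*) => W VW.
rewrite -!mulmxA (mulmxA V W) VW mul1mx (mulmxA (diag_mx _) (diag_mx _)) mulmx_diag.
congr (_ *m (diag_mx _ *m _)).
by apply/rowP => j; rewrite !mxE evE // exprS rmorphM.
Qed.

Lemma quad_pow n (M : 'M[C]_n.+1) k x : M \is hermsymmx ->
  (x *m M ^+ k *m x^t*) 0 0 = (\sum_j wt M x j * ev M j ^+ k)%:C.
Proof.
move=> hM; rewrite spectralX // !mulmxA.
set y := x *m (spectralmx M)^t*.
rewrite -[_ *m spectralmx M *m _]mulmxA.
have -> : spectralmx M *m x^t* = y^t* by rewrite /y trmx_mul map_mxM trmxCK.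
rewrite mxE rmorph_sum; apply: eq_bigr => j _.
rewrite mul_mx_diag [X in X * _]mxE [X in _ * X * _]mxE (_ : (y^t*) j 0 = Num.conj (y 0 j)); last by rewrite !mxE.
by rewrite mulrAC mul_conjE -rmorphM.
Qed.

Lemma tr_pow n (M : 'M[C]_n.+1) k : M \is hermsymmx ->
  \tr (M ^+ k) = (\sum_j ev M j ^+ k)%:C.
Proof.
move=> hM; rewrite spectralX // mxtrace_mulC mulmxA spectral_mul mul1mx mxtrace_diag.
by rewrite rmorph_sum; apply: eq_bigr => j _; rewrite mxE.
Qed.

Lemma herm_pow n (M : 'M[C]_n.+1) k : M \is hermsymmx -> (M ^+ k)^t* = M ^+ k.
Proof.
move=> /hermP hM; elim: k => [|k IH].
  by rewrite expr0 trmx1 map_mx1.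
by rewrite {1}exprSr exprS -!mulmxE trmx_mul map_mxM hM IH.
Qed.

Lemma norm2_pow n (M : 'M[C]_n.+1) k x : M \is hermsymmx ->
  norm2 (x *m M ^+ k) = \sum_j wt M x j * ev M j ^+ (2 * k).
Proof.
move=> hM; apply: complexI; rewrite -quad_pow // -norm2E.
rewrite trmx_mul map_mxM herm_pow // mulmxA -[x *m _ *m _]mulmxA mulmxE -exprD.
by rewrite addnn -mul2n.
Qed.

Lemma size_eigenvalues n (M : 'M[C]_n) : size (eigenvalues M) = n.
Proof. by rewrite /eigenvalues size_sort size_map -cardE card_ord. Qed.

Lemma sum_eigval n (M : 'M[C]_n) (f : R -> R) :
  \sum_(k < n) f (eigval M k) = \sum_j f (ev M j).
Proof.
transitivity (\sum_(x <- eigenvalues M) f x).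
  by rewrite (big_nth 0) size_eigenvalues big_mkord.
rewrite (perm_big [seq complex.Re (spectral_diag M 0 j) | j : 'I_n]) /=.
  by rewrite big_map big_enum.
by rewrite /eigenvalues perm_sort.
Qed.

Lemma mem_eigenvalues n (M : 'M[C]_n) j : ev M j \in eigenvalues M.
Proof. by rewrite /eigenvalues mem_sort; apply/mapP; exists j; rewrite ?mem_enum. Qed.

Lemma ge_transitive : transitive (>=%R : rel R).
Proof. by move=> x y z h1 h2; exact: le_trans h2 h1. Qed.

Lemma ev_le_max n (M : 'M[C]_n.+1) j : ev M j <= lambda_max M.
Proof.
have hs : sorted >=%R (eigenvalues M) by apply: sort_sorted; move=> x y; exact: ge_total.
have hj := mem_eigenvalues M j.
rewrite -(nth_index 0 hj) /lambda_max /eigval.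
have /= := sorted_leq_nth ge_transitive lexx 0 hs 0%N (index (ev M j) (eigenvalues M)).
by apply; rewrite ?inE ?index_mem ?size_eigenvalues.
Qed.

Lemma ev_ge_min n (M : 'M[C]_n.+1) j : lambda_min M <= ev M j.
Proof.
have hs : sorted >=%R (eigenvalues M) by apply: sort_sorted; move=> x y; exact: ge_total.
have hj := mem_eigenvalues M j.
rewrite -(nth_index 0 hj) /lambda_min /eigval.
have /= := sorted_leq_nth ge_transitive lexx 0 hs (index (ev M j) (eigenvalues M)) n.
apply; rewrite ?inE ?index_mem ?size_eigenvalues //.
by rewrite -ltnS -[X in (_ < X)%N](size_eigenvalues M) index_mem.
Qed.

Lemma rayleigh_max n (M : 'M[C]_n.+1) x : M \is hermsymmx ->
  complex.Re ((x *m M *m x^t*) 0 0) <= lambda_max M * norm2 x.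
Proof.
move=> hM; have := quad_pow 1 x hM; rewrite expr1 => -> /=.
rewrite -(sum_wt M x) mulr_sumr ler_sum // => j _; rewrite expr1 mulrC.
by rewrite ler_wpM2r ?wt_ge0 ?ev_le_max.
Qed.

Lemma rayleigh_min n (M : 'M[C]_n.+1) x : M \is hermsymmx ->
  lambda_min M * norm2 x <= complex.Re ((x *m M *m x^t*) 0 0).
Proof.
move=> hM; have := quad_pow 1 x hM; rewrite expr1 => -> /=.
rewrite -(sum_wt M x) mulr_sumr ler_sum // => j _; rewrite expr1 [leRHS]mulrC.
by rewrite ler_wpM2r ?wt_ge0 ?ev_ge_min.
Qed.

Lemma eigenvec n (M : 'M[C]_n.+1) j : M \is hermsymmx ->
  row j (spectralmx M) *m M = (ev M j)%:C *: row j (spectralmx M).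
Proof.
move=> hM; rewrite {2}(spectralE hM) -!row_mul !mulmxA spectral_mul mul1mx.
rewrite mul_diag_mx; apply/rowP => k; rewrite !mxE.
by rewrite evE.
Qed.

Lemma eigenvec_norm n (M : 'M[C]_n.+1) j : norm2 (row j (spectralmx M)) = 1.
Proof.
apply: complexI; rewrite -norm2E -dotmxE.
by have /row_unitarymxP -> := spectral_unitarymx M; rewrite eqxx.
Qed.

(** The rows of [P] are multiples of an eigenvector [v] because the rank is one;
    as [P] is its own adjoint, the column of the factors is a multiple of the
    adjoint of [v], and the eigenvalue fixes the factor. *)
Lemma rank1_herm n (P : 'M[C]_n.+1) (theta : R) : P \is hermsymmx -> \rank P = 1%N ->
  theta != 0 -> eigenvalue P theta%:C ->
  exists v : 'rV[C]_n.+1, norm2 v = 1 /\ P = theta%:C *: (v^t* *m v).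
Proof.
move=> hP rP th /eigenvalueP [v0 v0P v0n].
have thC : theta%:C != 0 by rewrite -(inj_eq (@complexI R)) in th.
have n0 : 0 < norm2 v0.
  rewrite lt_def norm2_ge0 andbT; apply: contraNneq v0n => h.
  apply/eqP/rowP => i; rewrite mxE; apply: sqmod_eq0.
  move/eqP: h; rewrite psumr_eq0 => [/allP/(_ i)|? _]; last exact: sqmod_ge0.
  by rewrite mem_index_enum => /(_ isT)/eqP.
pose c := (Num.sqrt (norm2 v0))^-1.
have c0 : c%:C != 0.
  by rewrite (inj_eq (@complexI R)) invr_eq0 gt_eqF // sqrtr_gt0.
pose v := c%:C *: v0.
have nv : norm2 v = 1.
  rewrite /norm2; under eq_bigr do rewrite mxE sqmodM sqmodR.
  by rewrite -mulr_sumr /c exprVn sqr_sqrtr ?ltW // mulVf ?gt_eqF.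
have vP : v *m P = theta%:C *: v.
  by rewrite /v -scalemxAl v0P !scalerA mulrC.
have vn : v != 0 by rewrite scaler_eq0 negb_or c0.
exists v; split=> //.
have vsub : (v <= P)%MS.
  have -> : v = theta%:C^-1 *: (v *m P) by rewrite vP scalerA mulVf // scale1r.
  by rewrite scalemx_sub // submxMl.
have Psub : (P <= v)%MS.
  have := mxrank_leqif_sup vsub; rewrite rP rank_rV vn /=.
  by case=> _ <-.
have /submxP [D PD] := Psub.
have PD' : P = v^t* *m D^t* by rewrite -(hermP hP) PD trmx_mul map_mxM.
have vv : v *m v^t* = 1%:M.
  by apply/rowP => i; rewrite !ord1 norm2E nv mxE.
have Dv : D = theta%:C *: v^t*.
  have : (v *m P)^t* = D.
    rewrite trmx_mul map_mxM (hermP hP) {1}PD -mulmxA vv mulmx1.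
    by [].
  move=> <-; rewrite vP; apply/matrixP => i j; rewrite !mxE rmorphM.
  by congr (_ * _); rewrite -[LHS]/(conjc _) conjc_real.
by rewrite {1}PD Dv scalemxAl.
Qed.
End spectral.

(** * Rank one perturbations and the secular equation *)

Section rank_one.
Variable R : realType.
Notation C := R[i].

Lemma mul_row_col1 n (u v : 'rV[C]_n) : u *m v^t* = ((u *m v^t*) 0 0)%:M.
Proof. by apply/rowP => i; rewrite !ord1 [RHS]mxE eqxx mulr1n. Qed.

Lemma norm2Z n (z : C) (x : 'rV[C]_n) : norm2 (z *: x) = sqmod z * norm2 x.
Proof. by rewrite /norm2 mulr_sumr; apply: eq_bigr => i _; rewrite mxE sqmodM. Qed.

(** The kernel is the line of [v], and [u] minus [(u v) v], where [(u v)] is the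
    inner product, is orthogonal to it. *)
Lemma proj_normE n (v u : 'rV[C]_n.+1) (theta : R) : theta != 0 -> norm2 v = 1 ->
  proj_norm u (kermx ((theta%:C)%:M - theta%:C *: (v^t* *m v))) =
  Num.sqrt (sqmod ((u *m v^t*) 0 0)).
Proof.
move=> th nv.
have thC : theta%:C != 0 by rewrite -(inj_eq (@complexI R)) in th.
have vv : v *m v^t* = 1%:M by rewrite mul_row_col1 norm2E nv.
set K := kermx _; set al := (u *m v^t*) 0 0.
have hK : K = K *m v^t* *m v.
  have /eqP := mulmx_ker ((theta%:C)%:M - theta%:C *: (v^t* *m v)).
  rewrite -/K mulmxBr mul_mx_scalar -scalemxAr -scalerBr scaler_eq0 (negbTE thC) /=.
  by rewrite subr_eq0 mulmxA => /eqP.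
have vK : (v <= K)%MS.
  apply/sub_kermxP; rewrite mulmxBr mul_mx_scalar -scalemxAr mulmxA vv mul1mx.
  by rewrite subrr.
have up : u *m proj_ortho K = al *: v.
  rewrite -[u](subrK (al *: v)) mulmxDl proj_ortho_0; last first.
    apply/orthomx1P; rewrite hK !trmx_mul !map_mxM trmxCK mulmxA mulmxBl.
    by rewrite -scalemxAl vv mul_row_col1 -/al scalemx1 subrr mul0mx.
  by rewrite add0r proj_ortho_id // scalemx_sub.
by rewrite /proj_norm up vnormE norm2Z nv mulr1.
Qed.

(** Test the Rayleigh quotient of the perturbed matrix at an eigenvector of [X]. *)
Lemma lambda_max_rank1 n (X : 'M[C]_n.+1) (v : 'rV[C]_n.+1) (theta : R) j :
  X \is hermsymmx -> X + theta%:C *: (v^t* *m v) \is hermsymmx ->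
  0 < theta -> ev X j <= lambda_max (X + theta%:C *: (v^t* *m v)).
Proof.
move=> hX hXP th; set e := row j (spectralmx X).
have ne : norm2 e = 1 := eigenvec_norm X j.
have := rayleigh_max e hXP; rewrite ne mulr1; apply: le_trans.
rewrite mulmxDr mulmxDl mxE eigenvec // -/e -scalemxAl [X in X + _]mxE norm2E ne mulr1.
rewrite -scalemxAr -scalemxAl (mulmxA e) -(mulmxA (e *m _)).
have -> : v *m e^t* = (e *m v^t*)^t* by rewrite trmx_mul map_mxM trmxCK.
by rewrite [X in _ + X]mxE norm2E -rmorphM -rmorphD /= lerDl mulr_ge0 ?norm2_ge0 // ltW.
Qed.

Lemma lambda_min_rank1 n (X : 'M[C]_n.+1) (v : 'rV[C]_n.+1) (theta : R) j :
  X \is hermsymmx -> X + theta%:C *: (v^t* *m v) \is hermsymmx ->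
  theta < 0 -> lambda_min (X + theta%:C *: (v^t* *m v)) <= ev X j.
Proof.
move=> hX hXP th; set e := row j (spectralmx X).
have ne : norm2 e = 1 := eigenvec_norm X j.
have := rayleigh_min e hXP; rewrite ne mulr1 => /le_trans; apply.
rewrite mulmxDr mulmxDl mxE eigenvec // -/e -scalemxAl [X in X + _]mxE norm2E ne mulr1.
rewrite -scalemxAr -scalemxAl (mulmxA e) -(mulmxA (e *m _)).
have -> : v *m e^t* = (e *m v^t*)^t* by rewrite trmx_mul map_mxM trmxCK.
by rewrite [X in _ + X]mxE norm2E -rmorphM -rmorphD /= gerDl mulr_le0_ge0 ?norm2_ge0 // ltW.
Qed.

(** In an eigenbasis of [X], and with [al] the inner product of [u] and [v], the
    eigenvector equation reads [(l - ev X j) * u_j = theta * al * v_j]. For nonzero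
    [al] it determines [u] wherever [v_j] is nonzero; pairing with [v] gives the
    sum, and [u] having norm one gives the inequality. A vanishing denominator is
    harmless in a term of zero weight, where the quotient is zero by convention. *)
Lemma secular n (X : 'M[C]_n.+1) (u v : 'rV[C]_n.+1) (theta l : R) :
  X \is hermsymmx -> norm2 u = 1 -> theta != 0 ->
  u *m (X + theta%:C *: (v^t* *m v)) = l%:C *: u ->
  (u *m v^t*) 0 0 != 0 ->
  [/\ forall j, wt X v j != 0 -> ev X j != l,
      \sum_j wt X v j / (l - ev X j) = theta^-1 &
      theta ^+ 2 * sqmod ((u *m v^t*) 0 0) *
        \sum_j wt X v j / (l - ev X j) ^+ 2 <= 1].
Proof.
move=> hX nu th hu; set al := (u *m v^t*) 0 0 => al0.
have thC : theta%:C != 0 by rewrite -(inj_eq (@complexI R)) in th.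
set V := spectralmx X.
pose y j := (u *m V^t*) 0 j; pose z j := (v *m V^t*) 0 j.
have key j : (l - ev X j)%:C * y j = theta%:C * al * z j.
  have : u *m X *m V^t* = l%:C *: (u *m V^t*) - (theta%:C * al) *: (v *m V^t*).
    have -> : u *m X = l%:C *: u - (theta%:C * al) *: v.
      rewrite -hu mulmxDr -scalemxAr mulmxA mul_row_col1 -/al mul_scalar_mx scalerA.
      by rewrite addrK.
    by rewrite mulmxBl -!scalemxAl.
  have -> : u *m X *m V^t* = u *m V^t* *m diag_mx (spectral_diag X).
    rewrite {1}(spectralE hX) -/V !mulmxA -[_ *m V *m _]mulmxA.
    by rewrite (spectral_mul X) mulmx1.
  move=> /rowP /(_ j); rewrite mul_mx_diag [LHS]mxE [RHS]mxE [X in X + _]mxE [X in _ + X]mxE [X in _ - X]mxE evE //.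
  rewrite -/(y j) -/(z j) => h.
  by rewrite rmorphB /= mulrBl [_ * y j in X in _ - X]mulrC h opprB addrC subrK.
have ne j : wt X v j != 0 -> ev X j != l.
  apply: contraNneq => e.
  have /eqP := key j; rewrite e subrr mul0r eq_sym !mulf_eq0 (negbTE thC) (negbTE al0) /=.
  by rewrite /wt -/V -/(z j) => /eqP ->; rewrite /sqmod /= expr0n addr0.
have wE j : wt X v j = sqmod (z j) by [].
have w0 j : wt X v j = 0 -> z j = 0 by move=> /sqmod_eq0.
split=> //.
  apply: complexI; apply: (mulfI al0).
  rewrite fmorphV.
  apply: (mulIf thC); rewrite mulfVK //.
  transitivity (\sum_j y j * Num.conj (z j)); last first.
    have -> : al = (u *m V^t* *m (v *m V^t*)^t*) 0 0.
      rewrite trmx_mul map_mxM trmxCK mulmxA -[_ *m V]mulmxA.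
      by rewrite (spectral_mulV X) mulmx1.
    by rewrite mxE; apply: eq_bigr => j _; rewrite [X in _ = _ * X]mxE [X in _ = _ * Num.conj X]mxE.
  rewrite mulrAC rmorph_sum mulr_sumr; apply: eq_bigr => j _.
  have [/w0 wj|/[dup] wj /ne nj] := eqVneq (wt X v j) 0.
    by rewrite wE wj rmorph0 mulr0 /sqmod /= expr0n addr0 mul0r mulr0.
  have lj : (l - ev X j)%:C != 0.
    by rewrite (inj_eq (@complexI R)) subr_eq0 eq_sym.
  apply: (mulfI lj); rewrite [RHS]mulrA key wE rmorphM fmorphV /= -mul_conjE.
  by rewrite mulrCA [_%:C * (_ / _)]mulrC divfK // [al * _]mulrC !mulrA.
have <- : norm2 u = 1 := nu.
rewrite -(sum_wt X u) mulr_sumr ler_sum // => j _.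
rewrite [leRHS]/(wt X u j) /wt -/V -/(y j).
have [wj|/[dup] wj /ne nj] := eqVneq (wt X v j) 0.
  by rewrite -/(wt X v j) wj mul0r mulr0 sqmod_ge0.
have lj : l - ev X j != 0 by rewrite subr_eq0 eq_sym.
have := congr1 (@sqmod R) (key j); rewrite !sqmodM !sqmodR => h.
rewrite -/(z j) mulrA -h le_eqVlt; apply/orP; left; apply/eqP.
by field.
Qed.
End rank_one.

(** * Secular equations at the edge of the spectrum *)

Lemma near_ex2 (U : Type) (F : set_system U) {FF : ProperFilter F} (A B : set U) :
  F A -> F B -> exists x, A x /\ B x.
Proof. by move=> FA FB; exact: filter_ex (filterI FA FB). Qed.

Section deterministic.
Variable R : realType.

(** Write [g_n z] for the sum with limit [G z]. Each [g_n] decreases above the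
    points [l n j], so [g_n z < theta^-1] excludes a solution [lt n] of the secular
    equation beyond [z]; hence [lt n <= z]. The sum of the squared inverses at
    [lt n] is then at least the difference quotient of [g_n] on [z, z'], which
    tends to that of [G] and so is as large as desired; this quotient stands in for
    the integral of [(z - t) ^- 2]. *)
Lemma subcritical_core (G : R -> R) (b theta : R)
    (l w : forall n : nat, 'I_n.+1 -> R) (lt q : nat -> R) :
  (forall n j, 0 <= w n j) ->
  (forall e, 0 < e -> \forall n \near \oo, forall j, l n j <= b + e) ->
  (forall z, b < z -> (fun n => \sum_j w n j / (z - l n j)) @ \oo --> G z) ->
  0 < theta -> (forall z, b < z -> G z < theta^-1) ->
  (forall K, 0 <= K -> exists z z', [/\ b < z, z < z' & K * (z' - z) <= G z - G z']) ->
  (forall n, 0 <= q n) ->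
  (forall n, q n != 0 ->
     [/\ forall j, w n j != 0 -> l n j < lt n,
         \sum_j w n j / (lt n - l n j) = theta^-1 &
         theta ^+ 2 * q n * \sum_j w n j / (lt n - l n j) ^+ 2 <= 1]) ->
  q @ \oo --> (0 : R).
Proof.
move=> w0 lb gG th Gth Gd q0 Hq; apply/cvgr0Pnorm_le => e e0.
(* [K] is the lower bound on the sum of squares that forces [q n <= e]. *)
pose K := (theta ^+ 2 * e)^-1.
have K0 : 0 < K by rewrite invr_gt0 mulr_gt0 ?exprn_gt0.
have [z [z' [bz zz' hK]]] := Gd (K + 1) (addr_ge0 (ltW K0) ler01).
have dz : 0 < z' - z by rewrite subr_gt0.
have c1 : \forall n \near \oo, \sum_j w n j / (z - l n j) < theta^-1.
  exact: (cvgr_lt _ (gG z bz) _ (Gth z bz)).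
have c2 : \forall n \near \oo,
    K * (z' - z) < \sum_j w n j / (z - l n j) - \sum_j w n j / (z' - l n j).
  apply: (cvgr_gt _ (cvgB (gG z bz) (gG z' (lt_trans bz zz')))).
  by apply: lt_le_trans hK; rewrite ltr_pM2r // ltrDl.
have c3 : \forall n \near \oo, forall j, l n j < z.
  have := lb ((z - b) / 2); rewrite divr_gt0 ?subr_gt0 // => /(_ isT).
  apply: filterS => n h j; apply: le_lt_trans (h j) _; lra.
near=> n; rewrite ger0_norm //.
have [->|/Hq [h1 h2 h3]] := eqVneq (q n) 0; first exact: ltW.
have lz j : l n j < z by move: j; near: n.
have ltz : lt n <= z.
  rewrite leNgt; apply/negP => zl.
  have : \sum_j w n j / (z - l n j) < theta^-1 by near: n.
  rewrite -h2 ltNge => /negP; apply; apply: ler_sum => j _.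
  rewrite ler_wpM2l // lef_pV2 ?posrE ?subr_gt0 // ?lerD2r ?ltW //.
  exact: lt_trans (lz j) zl.
have h4 : K <= \sum_j w n j / (lt n - l n j) ^+ 2.
  rewrite -(ler_pM2r dz); apply: ltW.
  have : K * (z' - z) < \sum_j w n j / (z - l n j) - \sum_j w n j / (z' - l n j)
    by near: n.
  move/lt_le_trans; apply; rewrite -sumrB mulr_suml ler_sum // => j _.
  have [->|/h1 lj] := eqVneq (w n j) 0; first by rewrite !mul0r subrr.
  have lzj := lz j.
  have a1 : 0 < z - l n j by lra.
  have a2 : 0 < z' - l n j by lra.
  have a3 : 0 < lt n - l n j by lra.
  rewrite -mulrBr -mulrA ler_wpM2l //.
  have -> : (z - l n j)^-1 - (z' - l n j)^-1 =
     (z' - z) * ((z - l n j) * (z' - l n j))^-1.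
    by field; rewrite !gt_eqF.
  rewrite [leRHS]mulrC ler_wpM2l ?(ltW dz) // lef_pV2 ?posrE ?mulr_gt0 ?exprn_gt0 //.
  by rewrite expr2 ler_pM ?(ltW a3) // lerB //; lra.
have t2 : 0 < theta ^+ 2 by rewrite exprn_gt0.
have : theta ^+ 2 * q n * K <= 1.
  by apply: le_trans h3; rewrite ler_wpM2l // mulr_ge0 // ltW.
by rewrite /K -ler_pdivlMr ?invr_gt0 ?mulr_gt0 // invrK mul1r ler_pM2l.
Unshelve. all: by end_near.
Qed.

(** Passing from [z] to [z'] each summand loses at least the fixed multiple [k] of
    its weight, because the points stay above [A]; strictness survives the limit. *)
Lemma stieltjes_strict (G : R -> R) (b A : R) (l w : forall n : nat, 'I_n.+1 -> R) :
  (forall n j, 0 <= w n j) -> (forall n, \sum_j w n j = 1) ->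
  (forall e, 0 < e -> \forall n \near \oo, forall j, l n j <= b + e) ->
  (\forall n \near \oo, forall j, A <= l n j) ->
  (forall z, b < z -> (fun n => \sum_j w n j / (z - l n j)) @ \oo --> G z) ->
  forall z z', b < z -> z < z' -> G z' < G z.
Proof.
move=> w0 w1 lb lA gG z z' bz zz'.
have c3 : \forall n \near \oo, forall j, l n j < z.
  have := lb ((z - b) / 2); rewrite divr_gt0 ?subr_gt0 // => /(_ isT).
  apply: filterS => n h j; apply: le_lt_trans (h j) _; lra.
have Az : A < z.
  have [n [/(_ ord0) h1 /(_ ord0) h2]] := near_ex2 lA c3.
  exact: le_lt_trans h1 h2.
have bz' : b < z' := lt_trans bz zz'.
pose k := (z' - z) / ((z - A) * (z' - A)).
have k0 : 0 < k by rewrite divr_gt0 ?mulr_gt0 ?subr_gt0 // (lt_trans Az).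
rewrite -subr_gt0; apply: lt_le_trans k0 _.
rewrite leNgt; apply/negP => hk.
have hn : \forall n \near \oo, \sum_j w n j / (z - l n j) - \sum_j w n j / (z' - l n j) < k.
  exact: (cvgr_lt _ (cvgB (gG z bz) (gG z' bz')) _ hk).
have [n [[/= c3n lAn]]] := near_ex2 (filterI c3 lA) hn.
rewrite ltNge => /negP; apply.
rewrite -[k]mul1r -(w1 n) mulr_suml [leRHS](_ : _ = \sum_j (w n j / (z - l n j) - w n j / (z' - l n j))); last by rewrite sumrB.
apply: ler_sum => j _.
have lzj := c3n j; have Aj := lAn j.
have a1 : 0 < z - l n j by lra.
have a2 : 0 < z' - l n j by lra.
rewrite -mulrBr ler_wpM2l //.
have -> : (z - l n j)^-1 - (z' - l n j)^-1 =
   (z' - z) * ((z - l n j) * (z' - l n j))^-1.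
  by field; rewrite !gt_eqF.
have a3 : z - l n j <= z - A by lra.
have a4 : z' - l n j <= z' - A by lra.
have a5 : 0 < (z - A) * (z' - A) by rewrite mulr_gt0 // ?(lt_le_trans a1 a3) ?(lt_le_trans a2 a4).
rewrite /k ler_wpM2l ?subr_ge0 ?(ltW zz') // lef_pV2 ?posrE ?a5 ?mulr_gt0 //.
by apply: ler_pM => //; exact: ltW. 
Qed.

Lemma stieltjes_ge0 (G : R -> R) (b : R) (l w : forall n : nat, 'I_n.+1 -> R) :
  (forall n j, 0 <= w n j) ->
  (forall e, 0 < e -> \forall n \near \oo, forall j, l n j <= b + e) ->
  (forall z, b < z -> (fun n => \sum_j w n j / (z - l n j)) @ \oo --> G z) ->
  forall z, b < z -> 0 <= G z.
Proof.
move=> w0 lb gG z bz.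
have c3 : \forall n \near \oo, forall j, l n j <= z.
  have := lb (z - b); rewrite subr_gt0 => /(_ bz).
  by apply: filterS => n h j; rewrite (le_trans (h j)) // subrKC.
rewrite leNgt; apply/negP => hk.
have [n [/= c3n]] := near_ex2 c3 (cvgr_lt _ (gG z bz) _ hk).
rewrite ltNge => /negP; apply.
by apply: sumr_ge0 => j _; rewrite divr_ge0 // subr_ge0.
Qed.

Lemma right_limE (G : R -> R) (b : R) :
  (forall z z', b < z -> z < z' -> G z' < G z) ->
  (G z)%:E @[z --> b^'+] --> ereal_sup [set (G z)%:E | z in `]b, +oo[].
Proof.
move=> Gd; apply: nonincreasing_at_right_cvge => //.
move=> x y; rewrite !in_itv /= !andbT => bx by_; rewrite le_eqVlt.
by case/predU1P => [->//|xy]; rewrite lee_fin ltW // Gd.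
Qed.

Lemma lt_right_lim (G : R -> R) (b z : R) :
  (forall z z', b < z -> z < z' -> G z' < G z) ->
  b < z -> ((G z)%:E < right_lim G b)%E.
Proof.
move=> Gd bz.
have -> : right_lim G b = _ := cvg_lim (@ereal_hausdorff _) (right_limE Gd).
have m1 : b < (b + z) / 2 by lra.
have m2 : (b + z) / 2 < z by lra.
apply: (@lt_le_trans _ _ (G ((b + z) / 2))%:E); first by rewrite lte_fin Gd.
by apply: ereal_sup_ubound; exists ((b + z) / 2) => //=; rewrite in_itv /= andbT.
Qed.

Lemma left_limE (f : R -> R) (a : R) : left_lim f a = right_lim (f \o -%R) (- a).
Proof. by rewrite /left_lim /right_lim -{1}(opprK a) at_leftN. Qed.

(** Reflecting the line turns [G] into a function that decreases above [- a]. *)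
Lemma left_lim_lt (G : R -> R) (a z : R) :
  (forall z z', - a < z -> z < z' -> - G (- z') < - G (- z)) ->
  - a < z -> (left_lim G a < (G (- z))%:E)%E.
Proof.
move=> Gd az; rewrite left_limE.
pose H x : R := - G (- x).
have HE : G \o -%R = (fun x => - H x) by apply/funext => x; rewrite /H /= opprK.
have h : ((H z)%:E < right_lim H (- a))%E := lt_right_lim (G := H) Gd az.
have c := right_limE (G := H) Gd.
suff -> : right_lim (G \o -%R) (- a) = (- right_lim H (- a))%E.
  by rewrite -[G (- z)]opprK -/(H z) EFinN lteN2.
rewrite /right_lim (cvg_lim (@ereal_hausdorff _) c) HE.
exact: (cvg_lim (@ereal_hausdorff _) (cvgeN c)).
Qed.

(** A limit that does not exist is the default value 0, which obeys the bound too. *)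
Lemma right_lim_ge0 (G : R -> R) (b : R) :
  (forall z, b < z -> 0 <= G z) -> (0 <= right_lim G b)%E.
Proof.
move=> G0; have [c|/dvgP] := pselect (cvg ((G z)%:E @[z --> b^'+])).
  apply: lime_ge => //; near=> x; rewrite lee_fin G0 //.
by rewrite /right_lim => ->.
Unshelve. all: by end_near.
Qed.

Lemma left_lim_le0 (G : R -> R) (a : R) :
  (forall z, - a < z -> 0 <= - G (- z)) -> (left_lim G a <= 0)%E.
Proof.
move=> G0; rewrite left_limE.
have [c|/dvgP] := pselect (cvg (((G \o -%R) z)%:E @[z --> (- a)^'+])).
  apply: lime_le => //; near=> x; rewrite lee_fin /= -oppr_ge0 G0 //.
by rewrite /right_lim => ->.
Unshelve. all: by end_near.
Qed.

(** A limit that does not exist takes the default value 0, so a negative derivative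
    is a true limit of difference quotients. *)
Lemma derive1_cvg (G : R -> R) (x : R) : derive1 G x < 0 ->
  h^-1 * (G (h + x) - G x) @[h --> 0^'] --> derive1 G x.
Proof.
move=> hG.
have c : cvg (h^-1 *: (G (h + x) - G x) @[h --> 0^']).
  apply: contrapT => /dvgP h; move: hG; rewrite /derive1 h.
  by rewrite (_ : point = 0) // ltxx.
exact: c.
Qed.

Lemma right_lim_Ny (f : R -> R) (b K : R) : right_lim f b = -oo%E ->
  exists2 x, b < x & f x <= K.
Proof.
move=> h; have [c|/dvgP] := pselect (cvg ((f z)%:E @[z --> b^'+])); last first.
  by move: h; rewrite /right_lim => ->.
have : (f z)%:E @[z --> b^'+] --> -oo%E by move: c; rewrite -h.
move/cvgeNyPle => /(_ K) hK.
have [x [/= h1 h2]] := near_ex2 (F := b^'+) hK (nbhs_right_gt b).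
by exists x.
Qed.

Lemma quot_right (G : R -> R) (b : R) : right_lim (derive1 G) b = -oo%E ->
  forall K, 0 <= K -> exists z z', [/\ b < z, z < z' & K * (z' - z) <= G z - G z'].
Proof.
move=> hG K K0.
have K1 : - (K + 1) < 0 by lra.
have K2 : - (K + 1) < - K by lra.
have [x bx hx] := right_lim_Ny (- (K + 1)) hG.
have hx0 : derive1 G _ < 0 := le_lt_trans hx K1.
have h0 := derive1_cvg hx0.
have hr : \forall h \near 0^'+, h^-1 * (G (h + x) - G x) <= - K.
  by apply: (cvgr_le _ (cvg_dnbhs_at_right h0)); exact: le_lt_trans hx K2.
have [h [/= h1 h2]] := near_ex2 (F := (0:R)^'+) hr (nbhs_right_gt 0).
exists x, (h + x); split => //; first by rewrite ltrDr.
move: h1; rewrite mulrC ler_pdivrMr // addrK; lra.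
Qed.

Lemma quot_left (G : R -> R) (a : R) : left_lim (derive1 G) a = -oo%E ->
  forall K, 0 <= K ->
  exists z z', [/\ - a < z, z < z' & K * (z' - z) <= - G (- z) - - G (- z')].
Proof.
rewrite left_limE => hG K K0.
have K1 : - (K + 1) < 0 by lra.
have K2 : - (K + 1) < - K by lra.
have [x bx hx] := right_lim_Ny (- (K + 1)) hG.
have hx0 : derive1 G _ < 0 := le_lt_trans hx K1.
have h0 := derive1_cvg hx0.
have hr : \forall h \near 0^'-, h^-1 * (G (h + - x) - G (- x)) <= - K.
  by apply: (cvgr_le _ (cvg_dnbhs_at_left h0)); exact: le_lt_trans hx K2.
have [h [/= h1 h2]] := near_ex2 (F := (0:R)^'-) hr (nbhs_left_lt 0).
exists x, (- h + x); split => //; first by lra.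
move: h1; rewrite mulrC ler_ndivrMr // addrK (_ : - (- h + x) = h - x); [lra|ring].
Qed.

End deterministic.

(** * From moments to Stieltjes transforms *)

Section weak_convergence.
Variable R : realType.

Lemma moment_poly (c t : forall n : nat, 'I_n.+1 -> R) :
  (forall k, (fun n => \sum_j c n j * t n j ^+ k) @ \oo --> (0 : R)) ->
  forall p : {poly R}, (fun n => \sum_j c n j * p.[t n j]) @ \oo --> (0 : R).
Proof.
move=> h p.
(* multiplying by a power of the variable makes the induction on [p] go through *)
suff H m : (fun n => \sum_j c n j * (p.[t n j] * t n j ^+ m)) @ \oo --> (0 : R).
  have := H 0%N; under eq_fun do under eq_bigr do rewrite expr0 mulr1.
  by [].
elim/poly_ind: p m => [|p a IH] m.
  under eq_fun do under eq_bigr do rewrite horner0 mul0r mulr0.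
  under eq_fun do rewrite big1 //.
  exact: cvg_cst.
have -> : (fun n => \sum_j c n j * ((p * 'X + a%:P).[t n j] * t n j ^+ m)) =
  (fun n => \sum_j c n j * (p.[t n j] * t n j ^+ m.+1)) +
  (fun n => a * \sum_j c n j * t n j ^+ m).
  apply/funext => n; rewrite fctE mulr_sumr -big_split /=.
  apply: eq_bigr => j _; rewrite hornerD hornerMX hornerC exprS.
  by rewrite mulrDl mulrDr -!mulrA (mulrCA a).
suff: ((fun n => \sum_j c n j * (p.[t n j] * t n j ^+ m.+1)) +
  (fun n => a * \sum_j c n j * t n j ^+ m)) @ \oo --> 0 + a * 0.
  by rewrite mulr0 addr0.
apply: cvgD; first exact: IH.
apply: cvgMl_tmp; exact: h.
Qed.

Lemma geometric_remainder (z m t : R) (K : nat) : z != m -> z != t ->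
  (z - t)^-1 = \sum_(k < K) (z - m) ^- k.+1 * (t - m) ^+ k +
               ((t - m) / (z - m)) ^+ K / (z - t).
Proof.
move=> zm zt.
have d1 : z - m != 0 by rewrite subr_eq0.
have d2 : z - t != 0 by rewrite subr_eq0.
elim: K => [|K IH]; first by rewrite big_ord0 add0r expr0 mul1r.
rewrite big_ord_recr /= {1}IH -addrA; congr (_ + _).
rewrite !expr_div_n !exprS.
have d3 : (z - m) ^+ K != 0 by rewrite expf_neq0.
by field; rewrite d1 d2 d3.
Qed.

(** On the disc of centre [m] and radius [r], which does not reach [z], the function
    [t |-> (z - t)^-1] is the uniform limit of the partial sums of a geometric
    series in [t - m], that is, of polynomials. *)
Lemma stieltjes_transfer (c t : forall n : nat, 'I_n.+1 -> R) (m r z : R) :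
  (forall n, \sum_j `|c n j| <= 2) ->
  (forall k, (fun n => \sum_j c n j * t n j ^+ k) @ \oo --> (0 : R)) ->
  (\forall n \near \oo, forall j, `|t n j - m| <= r) -> 0 <= r -> r < `|z - m| ->
  (fun n => \sum_j c n j / (z - t n j)) @ \oo --> (0 : R).
Proof.
move=> c2 hm ht r0 rz; apply/cvgr0Pnorm_le => e e0.
set D := `|z - m| - r.
have D0 : 0 < D by rewrite subr_gt0.
have zm0 : 0 < `|z - m| := le_lt_trans r0 rz.
pose rho := r / `|z - m|.
have rho0 : 0 <= rho by rewrite divr_ge0.
have rho1 : `|rho| < 1 by rewrite ger0_norm // ltr_pdivrMr // mul1r.
have e1 : 0 < e * D / 4 by rewrite divr_gt0 ?mulr_gt0.
(* the factor 4 pays for the total mass 2 of [c] and for half of [e] *)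
have [K hK] : exists K, rho ^+ K <= e * D / 4.
  have /cvgr0Pnorm_le /(_ _ e1) h := cvg_expr rho1.
  have [K hK] := filter_ex h.
  by exists K; move: hK; rewrite ger0_norm // exprn_ge0.
pose p : {poly R} := \sum_(k < K) (z - m) ^- k.+1 *: ('X - m%:P) ^+ k.
have pE x : p.[x] = \sum_(k < K) (z - m) ^- k.+1 * (x - m) ^+ k.
  rewrite /p horner_sum; apply: eq_bigr => k _.
  by rewrite hornerZ horner_exp !hornerE.
have /cvgr0Pnorm_le /(_ _ (divr_gt0 e0 (ltr0n _ 2))) hp := moment_poly hm p.
near=> n.
have tn : forall j, `|t n j - m| <= r by near: n.
have hpn : `|\sum_j c n j * p.[t n j]| <= e / 2 by near: n.
have zt j : D <= `|z - t n j|.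
  have -> : z - t n j = (z - m) - (t n j - m) by ring.
  by apply: le_trans (lerB_dist _ _); rewrite lerB.
have zmn : z != m by rewrite -subr_eq0 -normr_gt0.
have ztn j : z != t n j by rewrite -subr_eq0 -normr_gt0 (lt_le_trans D0).
have -> : \sum_j c n j / (z - t n j) = \sum_j c n j * p.[t n j] +
    \sum_j c n j * (((t n j - m) / (z - m)) ^+ K / (z - t n j)).
  rewrite -big_split /=; apply: eq_bigr => j _.
  by rewrite {1}(geometric_remainder K zmn (ztn j)) pE mulrDr.
apply: le_trans (ler_normD _ _) _.
rewrite [e](_ : _ = e / 2 + e / 2); last by field.
apply: lerD => //.
apply: le_trans (ler_norm_sum _ _ _) _.
apply: (@le_trans _ _ (\sum_j `|c n j| * (e / 4))).
  apply: ler_sum => j _; rewrite normrM ler_wpM2l // normrM normfV.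
  rewrite ler_pdivrMr ?(lt_le_trans D0) // normrX normrM normfV.
  apply: (@le_trans _ _ (rho ^+ K)).
    by apply: lerXn2r; rewrite ?nnegrE ?divr_ge0 // ler_wpM2r ?invr_ge0.
  apply: le_trans hK _; rewrite mulrAC; apply: ler_wpM2l => //.
  by rewrite divr_ge0 // ltW.
rewrite -mulr_suml.
have -> : e / 2 = 2 * (e / 4) by field.
by rewrite ler_wpM2r // divr_ge0 // ltW.
Unshelve. all: by end_near.
Qed.
End weak_convergence.

(** * Weak convergence of spectra and the Cauchy transform *)

Section cauchy.
Variable R : realType.
Local Notation C := R[i].

Lemma continuous_cst_sub (z s : R) : continuous (fun t : R => s * (z - t)).
Proof. by move=> t; apply: cvgMl_tmp; apply: cvgB; [exact: cvg_cst|exact: cvg_id]. Qed.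

Lemma measurable_invB (z : R) : measurable_fun setT (fun t : R => (z - t)^-1).
Proof.
have -> : [set: R] = [set z] `|` ~` [set z] by rewrite setUv.
apply/measurable_funU => //; first exact: measurableC.
split; first exact: measurable_fun_set1.
apply: open_continuous_measurable_fun; first by rewrite openC; exact: closed_eq.
move=> t; rewrite inE /= => tz.
apply: (@continuous_comp _ _ _ (fun t : R => z - t) (@GRing.inv R)).
  by apply: cvgB; [exact: cvg_cst|exact: cvg_id].
by apply: inv_continuous; rewrite subr_eq0 eq_sym; apply/eqP.
Qed.

Lemma Rintegral_empirical n (M : 'M[C]_n.+1) (f : R -> R) :
  continuous f -> (forall x, 0 <= f x) ->
  \int[empirical_measure M]_x f x = n.+1%:R^-1 * \sum_j f (ev M j).
Proof.
move=> cf f0.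
have mf : measurable_fun setT (EFin \o f).
  by apply: measurableT_comp => //; exact: continuous_measurable_fun.
rewrite /Rintegral /empirical_measure ge0_integral_mscale //; last by move=> x _; rewrite lee_fin.
rewrite ge0_integral_measure_sum //; last by move=> x _; rewrite lee_fin.
under eq_bigr do rewrite integral_dirac // diracT mul1e.
by rewrite sumEFin -EFinM /= sum_eigval.
Qed.

Variable mu : probability (measurableTypeR R) R.
Variable X : forall n, 'M[C]_n.+1.
Hypothesis Xmu : weak_cvg (fun n => empirical_measure (X n)) mu.

Lemma mu_lty : (mu setT < +oo)%E.
Proof. by rewrite (@probability_setT _ _ _ mu) ltry. Qed.

(** The function [phi] is positive exactly where the inequality fails. Its empirical
    integrals vanish eventually, so its integral is zero and it vanishes almost
    everywhere.
    The sign [s] selects the side of [z] on which the spectrum lies. *)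
Lemma empirical_gap (s z d : R) :
  (\forall n \near \oo, forall j, d <= s * (z - ev (X n) j)) ->
  {ae mu, forall t, d <= s * (z - t)}.
Proof.
move=> hd.
pose phi t := Num.min (1 : R) (Num.max 0 (d - s * (z - t))).
have cphi : continuous phi.
  move=> t; apply: (@continuous_min R R (cst 1) (fun t => Num.max 0 (d - s * (z - t)))).
    exact: cvg_cst.
  apply: (@continuous_max R R (cst 0) (fun t => d - s * (z - t))).
    exact: cvg_cst.
  by apply: cvgB; [exact: cvg_cst|exact: continuous_cst_sub].
have phi0 t : 0 <= phi t by rewrite /phi le_min ler01 le_max lexx.
have phi1 t : phi t <= 1 by rewrite /phi ge_min lexx.
have bphi : bounded_fun phi.
  exists 1; split; first exact: num_real.
  by move=> M M1 t _; rewrite /= ger0_norm // (le_trans (phi1 t)) // ltW.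
have mphi : measurable_fun setT (EFin \o phi).
  by apply: measurableT_comp => //; exact: continuous_measurable_fun.
have iphi : mu.-integrable setT (EFin \o phi).
  apply: measurable_bounded_integrable => //; first exact: mu_lty.
  exact: continuous_measurable_fun.
have I0 : \int[mu]_x phi x = 0.
  apply: (@cvg_unique _ (@Rhausdorff R) _ _ _ _ (Xmu cphi bphi)).
  have : (fun=> 0 : R) @ \oo --> (0 : R) by exact: cvg_cst.
  apply: cvg_trans; apply: near_eq_cvg; near=> n.
  rewrite Rintegral_empirical // big1 ?mulr0 // => j _.
  have hj : d <= s * (z - ev (X n) j) by move: j; near: n.
  by rewrite /phi max_l ?subr_le0 // min_r.
have : (\int[mu]_x `|(EFin \o phi) x|)%E = 0.
  transitivity (\int[mu]_x (EFin \o phi) x)%E.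
    by apply: eq_integral => x _ /=; rewrite ger0_norm.
  by rewrite -[LHS]fineK ?integrable_fin_num //; congr EFin.
move/(ae_eq_integral_abs mu measurableT mphi).
apply: filterS => t /(_ I) [] /eqP; apply: contraTT; rewrite -ltNge => h.
by rewrite gt_eqF // /phi lt_min ltr01 lt_max subr_gt0 h orbT.
Unshelve. all: by end_near.
Qed.

(** Almost everywhere, the inverse [(z - t)^-1] agrees with the continuous bounded
    function [s * h t], to which weak convergence applies. *)
Lemma empirical_cauchy (s z d : R) : s ^+ 2 = 1 -> 0 < d ->
  (\forall n \near \oo, forall j, d <= s * (z - ev (X n) j)) ->
  (fun n => \sum_j n.+1%:R^-1 / (z - ev (X n) j)) @ \oo --> cauchy_transform mu z.
Proof.
move=> s1 d0 hd.
pose h t := (Num.max d (s * (z - t)))^-1.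
have m0 t : 0 < Num.max d (s * (z - t)) by rewrite lt_max d0.
have ch : continuous h.
  move=> t; apply: (@continuous_comp _ _ _ (fun t => Num.max d (s * (z - t))) (@GRing.inv R)).
    apply: (@continuous_max R R (cst d) (fun t => s * (z - t))); first exact: cvg_cst.
    exact: continuous_cst_sub.
  by apply: inv_continuous; rewrite gt_eqF.
have h0 t : 0 <= h t by rewrite invr_ge0 ltW.
have h1 t : h t <= d^-1 by rewrite lef_pV2 ?posrE // le_max lexx.
have bh : bounded_fun h.
  exists d^-1; split; first exact: num_real.
  by move=> M M1 t _; rewrite /= ger0_norm // (le_trans (h1 t)) // ltW.
have mh : measurable_fun setT h by exact: continuous_measurable_fun.
have ih : mu.-integrable setT (EFin \o h).
  by apply: measurable_bounded_integrable => //; exact: mu_lty.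
have hE t : d <= s * (z - t) -> s * h t = (z - t)^-1.
  move=> dt; have p := lt_le_trans d0 dt.
  rewrite /h max_r // invfM mulrA.
  have s0 : s != 0 by apply: contraTneq p => ->; rewrite mul0r ltxx.
  by rewrite divff // mul1r.
have -> : cauchy_transform mu z = s * \int[mu]_x h x.
  rewrite -RintegralZl //; congr fine; apply: ae_eq_integral => //.
  - apply: measurableT_comp => //; exact: measurable_invB.
  - by apply: measurableT_comp => //; exact: measurable_funM.
  - move: (empirical_gap hd); apply: filterS; first exact: (ae_filter_ringOfSetsType mu).
    by move=> t /hE /= ->.
have : (fun n => s * \int[empirical_measure (X n)]_x h x) @ \oo --> s * \int[mu]_x h x.
  by apply: cvgMl_tmp; exact: Xmu.
apply: cvg_trans; apply: near_eq_cvg; near=> n.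
rewrite Rintegral_empirical // mulrCA -mulr_sumr; congr (_ * _).
rewrite mulr_sumr; apply: eq_bigr => j _; apply/hE.
by move: j; near: n.
Unshelve. all: by end_near.
Qed.
End cauchy.

(** * Plane rotations and the Casimir operator *)

Section rotations.
Variables (R : realType) (n : nat).
Local Notation C := R[i].
Local Notation M := 'M[C]_n.+1.

(** The generator of the rotations of the coordinate plane of [i] and [j]; it is zero
    when the indices agree. *)
Definition plane_gen (i j : 'I_n.+1) : M := delta_mx i j - delta_mx j i.

Lemma plane_gen_tr i j : (plane_gen i j)^T = - plane_gen i j.
Proof. by rewrite /plane_gen linearB /= !trmx_delta opprB. Qed.

Lemma conj_bool (b : bool) : Num.conj (b%:R : C) = b%:R.
Proof. by case: b; rewrite ?rmorph1 ?rmorph0. Qed.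

Lemma plane_gen_real i j : plane_gen i j ^ Num.conj = plane_gen i j.
Proof. by apply/matrixP => a b; rewrite !mxE rmorphB /= !conj_bool. Qed.

Lemma plane_gen_adj i j : (plane_gen i j)^t* = - plane_gen i j.
Proof. by rewrite plane_gen_tr map_mxN plane_gen_real. Qed.

Lemma plane_gen_sqr i j : plane_gen i j * plane_gen i j =
  (i == j)%:R *: (delta_mx i j + delta_mx j i) - delta_mx i i - delta_mx j j :> M.
Proof.
rewrite /plane_gen mulrBl !mulrBr -!mulmxE !mul_delta_mx_cond [j == i]eq_sym !eqxx.
case: eqP => [->|_]; first by rewrite !mulr1n scale1r; apply/matrixP => a b; rewrite !mxE; ring.
by rewrite !mulr0n scale0r !mulr1n; apply/matrixP => a b; rewrite !mxE; ring.
Qed.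

Lemma plane_gen_cube i j : plane_gen i j * plane_gen i j * plane_gen i j = - plane_gen i j :> M.
Proof.
have [<-|ij] := eqVneq i j; first by rewrite /plane_gen subrr !mulr0 oppr0.
rewrite plane_gen_sqr (negbTE ij) scale0r sub0r /plane_gen !(mulrBl, mulrBr, mulNr) -!mulmxE.
rewrite !mul_delta_mx_cond !eqxx [j == i]eq_sym (negbTE ij) !mulr0n !mulr1n.
by apply/matrixP => a b; rewrite !mxE; ring.
Qed.

Lemma sum_delta_diag : \sum_i delta_mx i i = 1 :> M.
Proof. by rewrite -[1]/(1%:M) mx1_sum_delta. Qed.

Lemma sum_kmx_sqr : \sum_i \sum_j plane_gen i j * plane_gen i j = (- (2 * n)%:R)%:M :> M.
Proof.
under eq_bigr do under eq_bigr do rewrite plane_gen_sqr.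
transitivity (\sum_i (2%:R *: delta_mx i i - n.+1%:R *: delta_mx i i - 1 : M)).
  apply: eq_bigr => i _; rewrite !sumrB sum_delta_diag; congr (_ - _ - _).
    rewrite (bigD1 i) //= eqxx scale1r big1 ?addr0.
      by rewrite scaler_nat mulr2n.
    by move=> j ji; rewrite eq_sym (negbTE ji) scale0r.
  by rewrite sumr_const card_ord scaler_nat.
rewrite !sumrB -!scaler_sumr sum_delta_diag sumr_const card_ord.
rewrite -(scaler_nat _ (1 : M)) -!scalerBl -[RHS]scalemx1; congr (_ *: _).
by rewrite natrM -natr1; ring.
Qed.

Lemma delta_mul_delta (B : M) i j k l :
  delta_mx i j * B * delta_mx k l = B j k *: delta_mx i l :> M.
Proof.
apply/matrixP => a b; rewrite -!mulmxE mxE (bigD1 k) //= big1 ?addr0; last first.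
  by move=> c ck; rewrite [X in _ * X]mxE (negbTE ck) mulr0.
rewrite mxE (bigD1 j) //= big1 ?addr0; last first.
  by move=> c cj; rewrite [X in X * _]mxE (negbTE cj) andbF mul0r.
rewrite !mxE !eqxx andbT /=.
by case: (a == i); case: (b == l); rewrite /= ?(mul0r, mul1r, mulr0, mulr1).
Qed.

Lemma mul_sandwichB (S : pzRingType) (x y B : S) :
  (x - y) * B * (x - y) = x * B * x - x * B * y - y * B * x + y * B * y.
Proof.
rewrite mulrBl mulrBr !mulrBl opprB [y * B * y - _]addrC addrA.
by rewrite [x * B * x - _ - _]addrAC.
Qed.

Lemma sum_kmx_conj (B : M) :
  \sum_i \sum_j plane_gen i j * B * plane_gen i j = 2%:R *: (B^T - (\tr B)%:M).
Proof.
have h i j : plane_gen i j * B * plane_gen i j = B j i *: delta_mx i j - B j j *: delta_mx i i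
   - B i i *: delta_mx j j + B i j *: delta_mx j i :> M.
  by rewrite /plane_gen mul_sandwichB !delta_mul_delta.
have BT : \sum_i \sum_j B j i *: delta_mx i j = B^T.
  by rewrite [RHS]matrix_sum_delta; apply: eq_bigr => i _; apply: eq_bigr => j _; rewrite mxE.
have Tr : \sum_i \sum_j B j j *: delta_mx i i = (\tr B)%:M :> M.
  transitivity (\sum_i \tr B *: (delta_mx i i : M)).
    by apply: eq_bigr => i _; rewrite -scaler_suml.
  by rewrite -scaler_sumr sum_delta_diag; exact: scalemx1.
under eq_bigr do under eq_bigr do rewrite h.
under eq_bigr do rewrite big_split /= !sumrB.
rewrite big_split /= !sumrB BT Tr.
rewrite [X in _ - X + _]exchange_big Tr [X in _ + X]exchange_big BT.
by rewrite scaler_nat mulr2n -[LHS]addrA; congr (_ + _); rewrite addrC.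
Qed.

(** The derivative at 0 of conjugation by [exp (t K)], transposed to act on [A]. *)
Definition comm (A K : M) : M := A * K - K * A.

(** The Casimir operator of the rotation group, each plane being counted twice. It
    acts by different scalars on the symmetric traceless and on the antisymmetric
    part of [B], whence the transpose. *)
Lemma casimir (B : M) : \sum_i \sum_j comm (comm B (plane_gen i j)) (plane_gen i j) =
  - (4%:R *: (n%:R *: B + B^T - (\tr B)%:M)).
Proof.
have h i j : comm (comm B (plane_gen i j)) (plane_gen i j) =
   B * (plane_gen i j * plane_gen i j) + (plane_gen i j * plane_gen i j) * B - 2%:R *: (plane_gen i j * B * plane_gen i j).
  move: (plane_gen i j) => K.
  by rewrite /comm mulrBl mulrBr !mulrA scaler_nat mulr2n opprB opprD addrACA.
under eq_bigr do under eq_bigr do rewrite h.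
under eq_bigr do rewrite sumrB big_split /= -mulr_sumr -mulr_suml -scaler_sumr.
rewrite sumrB big_split /= -mulr_sumr -mulr_suml -scaler_sumr sum_kmx_sqr sum_kmx_conj.
rewrite -!mulmxE mul_mx_scalar mul_scalar_mx.
rewrite natrM -scalerDl scalerA -[n%:R *: B + _ - _]addrA [in RHS]scalerDr opprD scalerA -[in RHS]scaleNr.
by congr (_ *: _ - _ *: _); ring.
Qed.

Lemma tr_rank1 (A : M) (v : 'rV[C]_n.+1) (th : C) :
  \tr (A * (th *: (v^t* *m v))) = th * (v *m A *m v^t*) 0 0.
Proof.
rewrite -mulmxE -scalemxAr mxtraceZ mulmxA mxtrace_mulC mulmxA; congr (_ * _).
by rewrite /mxtrace big_ord1.
Qed.

Lemma plane_gen_quad (y v : 'rV[C]_n.+1) i j :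
  (y *m plane_gen i j *m v^t*) 0 0 = y 0 i * Num.conj (v 0 j) - y 0 j * Num.conj (v 0 i).
Proof.
have h k l : (y *m delta_mx k l *m v^t*) 0 0 = y 0 k * Num.conj (v 0 l).
  rewrite mxE (bigD1 l) //= big1 ?addr0; last first.
    move=> c cl; rewrite [X in X * _](_ : _ = 0) ?mul0r // mxE big1 // => d _.
    by rewrite [X in _ * X]mxE (negbTE cl) andbF mulr0.
  rewrite [X in X * _](_ : _ = y 0 k); first by rewrite !mxE.
  rewrite mxE (bigD1 k) //= big1 ?addr0; first by rewrite mxE !eqxx mulr1.
  by move=> d dk; rewrite [X in _ * X]mxE (negbTE dk) mulr0.
by rewrite /plane_gen mulmxBr mulmxBl mxE h [X in _ + X]mxE h.
Qed.

Lemma sqmodD_le (x y : C) : sqmod (x - y) <= 2 * (sqmod x + sqmod y).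
Proof.
case: x => a b; case: y => c d; rewrite /sqmod /=.
by have := sqr_ge0 (a + c); have := sqr_ge0 (b + d); nra.
Qed.

Lemma sqmod_conj (x : C) : sqmod (Num.conj x) = sqmod x.
Proof. by case: x => a b; rewrite /sqmod /= sqrrN. Qed.

(** For [y = v *m A], each term is four times [theta ^+ 2] times the squared real
    part of [y_i v_j - y_j v_i], with [v] conjugated; summing over all pairs leaves
    the product of the norms of [y] and [v], with no factor of the dimension. *)
Lemma grad_bound (A : M) (v : 'rV[C]_n.+1) (th : R) : A^t* = A -> norm2 v = 1 ->
  \sum_i \sum_j complex.Re (\tr (comm A (plane_gen i j) * (th%:C *: (v^t* *m v)))) ^+ 2
    <= 16 * th ^+ 2 * norm2 (v *m A).
Proof.
move=> hA nv; set y := v *m A.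
have key i j : complex.Re (\tr (comm A (plane_gen i j) * (th%:C *: (v^t* *m v)))) ^+ 2 <=
   8 * th ^+ 2 * (sqmod (y 0 i) * sqmod (v 0 j) + sqmod (y 0 j) * sqmod (v 0 i)).
  rewrite tr_rank1 ReZ exprMn.
  set z := y 0 i * Num.conj (v 0 j) - y 0 j * Num.conj (v 0 i).
  have e1 : (v *m (A *m plane_gen i j) *m v^t*) 0 0 = z by rewrite mulmxA plane_gen_quad.
  have e2 : (v *m (plane_gen i j *m A) *m v^t*) 0 0 = - Num.conj z.
    rewrite -e1 -[RHS]/(- (((v *m (A *m plane_gen i j) *m v^t*) 0 0)^*)%R).
    have -> : plane_gen i j *m A = - ((A *m plane_gen i j)^t*).
      by rewrite trmx_mul map_mxM hA plane_gen_adj mulNmx opprK.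
    rewrite mulmxN mulNmx mxE; congr (- _).
    transitivity (((v *m (A *m plane_gen i j) *m v^t*)^t*) 0 0); last by rewrite mxE mxE.
    by rewrite !trmx_mul !map_mxM trmxCK !mulmxA.
  have -> : complex.Re ((v *m comm A (plane_gen i j) *m v^t*) 0 0) = 2 * complex.Re z.
    rewrite /comm -!mulmxE mulmxBr mulmxBl mxE e1 [X in _ + X]mxE e2 opprK.
    by case: z {e1 e2} => p q; rewrite ReD /=; ring.
  have : complex.Re z ^+ 2 <= sqmod z by rewrite /sqmod lerDl sqr_ge0.
  have := sqmodD_le (y 0 i * Num.conj (v 0 j)) (y 0 j * Num.conj (v 0 i)).
  rewrite -/z !sqmodM !sqmod_conj => h1 h2.
  rewrite exprMn.
  have t0 : 0 <= th ^+ 2 := sqr_ge0 th.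
  have := ler_wpM2l t0 (le_trans h2 h1); lra.
apply: (@le_trans _ _ (\sum_i \sum_j 8 * th ^+ 2 *
    (sqmod (y 0 i) * sqmod (v 0 j) + sqmod (y 0 j) * sqmod (v 0 i)))).
  by apply: ler_sum => i _; apply: ler_sum => j _; exact: key.
under eq_bigr do rewrite -mulr_sumr big_split /= -mulr_sumr -mulr_suml -/(norm2 v) -/(norm2 y) nv mulr1.
rewrite -mulr_sumr big_split /= -mulr_sumr -/(norm2 v) -/(norm2 y) nv mulr1.
lra.
Qed.
End rotations.

Section rot.
Variables (R : realType) (n : nat).
Local Notation C := R[i].
Local Notation M := 'M[C]_n.+1.

(** The exponential of [t K] for [s = sin t]: since [K ^+ 3 = - K], the exponential
    series is [1 + sin t K + (1 - cos t) K ^+ 2]. *)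
Definition rot (K : M) (s : R) : M :=
  1 + s%:C *: K + (1 - Num.sqrt (1 - s ^+ 2))%:C *: (K * K).

Definition re_tr (A P : M) : R := complex.Re (\tr (A * P)).

Lemma adjD (A B : M) : (A + B)^t* = A^t* + B^t*.
Proof. by apply/matrixP => i j; rewrite !mxE rmorphD. Qed.

Lemma adjZ (r : R) (A : M) : (r%:C *: A)^t* = r%:C *: A^t*.
Proof.
apply/matrixP => i j; rewrite !mxE rmorphM; congr (_ * _).
by rewrite -[LHS]/(conjc _) conjc_real.
Qed.

Lemma adjM (A B : M) : (A * B)^t* = B^t* * A^t*.
Proof. by rewrite -mulmxE trmx_mul map_mxM. Qed.

Lemma adj1 : (1 : M)^t* = 1.
Proof. by rewrite trmx1 map_mx1. Qed.

Lemma re_trD (A P Q : M) : re_tr A (P + Q) = re_tr A P + re_tr A Q.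
Proof. by rewrite /re_tr mulrDr mxtraceD ReD. Qed.

Lemma re_trZ (A P : M) (r : R) : re_tr A (r%:C *: P) = r * re_tr A P.
Proof. by rewrite /re_tr -scalerAr mxtraceZ ReZ. Qed.

Lemma re_trN (A P : M) : re_tr A (- P) = - re_tr A P.
Proof. by rewrite /re_tr mulrN raddfN ReN. Qed.

Lemma re_trDl (A B P : M) : re_tr (A + B) P = re_tr A P + re_tr B P.
Proof. by rewrite /re_tr mulrDl mxtraceD ReD. Qed.

Lemma re_trZl (A P : M) (r : R) : re_tr (r%:C *: A) P = r * re_tr A P.
Proof. by rewrite /re_tr -scalerAl mxtraceZ ReZ. Qed.

Lemma re_trNl (A P : M) : re_tr (- A) P = - re_tr A P.
Proof. by rewrite /re_tr mulNr raddfN ReN. Qed.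

Lemma re_tr_suml (I : Type) (r : seq I) (F : I -> M) (P : M) :
  re_tr (\sum_(i <- r) F i) P = \sum_(i <- r) re_tr (F i) P.
Proof. by rewrite /re_tr mulr_suml [\tr _]raddf_sum Re_sum. Qed.

Lemma re_tr_conj (A P U : M) : U^t* * U = 1 ->
  re_tr (U * A * U^t*) (U * P * U^t*) = re_tr A P.
Proof.
move=> h; rewrite /re_tr -!mulrA (mulrA (U^t*)) h mul1r -mulmxE mxtrace_mulC.
by rewrite mulmxE -!mulrA h mulr1.
Qed.

Lemma conj_expand (K L P : M) (a q : C) :
  (1 + a *: K + q *: L) * P * (1 + - a *: K + q *: L) =
  P + a *: (K * P - P * K) + q *: (L * P + P * L) - a ^+ 2 *: (K * P * K)
  + (a * q) *: (K * P * L - L * P * K) + q ^+ 2 *: (L * P * L).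
Proof.
have h Y : Y * (1 + - a *: K + q *: L) = Y - a *: (Y * K) + q *: (Y * L).
  by rewrite !mulrDr mulr1 -!scalerAr scaleNr.
have -> : (1 + a *: K + q *: L) * P = P + a *: (K * P) + q *: (L * P).
  by rewrite !mulrDl mul1r -!scalerAl.
rewrite h !mulrDl -!scalerAl.
move: (K * P) (L * P) (P * K) (P * L) => X Y Z W.
move: (X * K) (Y * K) (X * L) (Y * L) => A B D E.
by apply/matrixP => i j; rewrite !mxE; ring.
Qed.

Lemma re_tr_comb (A P X Y Z W V : M) (a q b c e : R) :
  re_tr A (P + a%:C *: X + q%:C *: Y - b%:C *: Z + c%:C *: W + e%:C *: V) =
  re_tr A P + a * re_tr A X + q * re_tr A Y - b * re_tr A Z + c * re_tr A W + e * re_tr A V.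
Proof. by rewrite !(re_trD, re_trN, re_trZ). Qed.

Variable K : M.
Hypothesis K_adj : K^t* = - K.
Hypothesis K_cube : K * K * K = - K.

Lemma rot_adj s : (rot K s)^t* = rot K (- s).
Proof.
rewrite /rot !adjD !adjZ adj1 adjM K_adj mulrNN sqrrN scalerN.
by rewrite rmorphN scaleNr.
Qed.

Let k (s : R) := 1 - Num.sqrt (1 - s ^+ 2).

Lemma rot_coef s : 0 <= s <= 1 ->
  [/\ 0 <= k s, k s <= s ^+ 2 & k s ^+ 2 = 2 * k s - s ^+ 2].
Proof.
move=> /andP[s0 s1].
have h : 0 <= 1 - s ^+ 2 by rewrite subr_ge0 expr_le1.
have q := sqr_sqrtr h; have q0 := sqrtr_ge0 (1 - s ^+ 2).
rewrite /k; move: (Num.sqrt _) q q0 => c q q0; split; nra.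
Qed.

Lemma rot_unitary s : 0 <= s <= 1 -> rot K s * (rot K s)^t* = 1.
Proof.
move=> hs; have [_ _ hk] := rot_coef hs.
have hk' : 2 * (k s)%:C - s%:C ^+ 2 - (k s)%:C ^+ 2 = 0.
  have -> : 2 = (2 : R)%:C :> C by rewrite -[2 in LHS]/(2%:R) -(rmorph_nat (real_complex R)).
  by rewrite -!rmorphXn -rmorphM -!rmorphB /= hk subrr.
rewrite rot_adj /rot sqrrN -/(k s) rmorphN -[X in X * _]mulr1 conj_expand.
have e2 : K * K * (K * K) = - (K * K) by rewrite mulrA K_cube mulNr.
rewrite !mulr1 !mul1r (mulrA K K K) e2 !subrr !scaler0 !addr0 scalerN scalerDr.
move: (K * K) => L; rewrite -[RHS]addr0 -!addrA; congr (_ + _).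
rewrite -!scaleNr -!scalerDl (_ : _ + _ = 0) ?scale0r // -hk'.
by move: (k s)%:C s%:C => x y; ring.
Qed.

Lemma rot_mulV s : 0 <= s <= 1 -> (rot K s)^t* * rot K s = 1.
Proof. by move=> /rot_unitary h; rewrite -mulmxE; apply: mulmx1C; rewrite mulmxE. Qed.

Lemma rot_commutes s : rot K s * K = K * rot K s.
Proof. by rewrite /rot !mulrDl !mulrDr mul1r mulr1 -!(scalerAl, scalerAr) mulrA. Qed.

Lemma comm_rot s (A : M) : 0 <= s <= 1 ->
  comm (rot K s * A * (rot K s)^t*) K = rot K s * comm A K * (rot K s)^t*.
Proof.
move=> hs; have hc := rot_commutes s.
have hc' : (rot K s)^t* * K = K * (rot K s)^t*.
  by have := congr1 (fun Y : M => Y^t*) hc; rewrite /= !adjM K_adj mulrN mulNr => /oppr_inj.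
rewrite /comm mulrBr mulrBl; congr (_ - _).
  by rewrite -!mulrA hc'.
by rewrite !mulrA hc.
Qed.

(** The bound is explicit and quadratic in [s] so that it holds uniformly over all
    realisations of random matrices with bounded entries. *)
Lemma re_tr_rot_taylor (A P : M) s : 0 <= s <= 1 ->
  `|re_tr A (rot K s * P * (rot K s)^t*) - re_tr A P - s * re_tr (comm A K) P| <=
   s ^+ 2 * (`|re_tr A (K * K * P + P * (K * K))| + `|re_tr A (K * P * K)| +
             `|re_tr A (K * P * (K * K) - K * K * P * K)| +
             `|re_tr A (K * K * P * (K * K))|).
Proof.
move=> hs; have [k0 ks _] := rot_coef hs; case/andP: hs => s0 s1.
have comm1 : re_tr (comm A K) P = re_tr A (K * P - P * K).
  rewrite /comm re_trDl re_trNl re_trD re_trN /re_tr -(mulrA A K P); congr (_ - complex.Re _).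
  by rewrite -mulrA -mulmxE mxtrace_mulC mulmxE mulrA.
rewrite rot_adj /rot sqrrN -/(k s) rmorphN conj_expand -!rmorphXn -rmorphM re_tr_comb -comm1.
move: (re_tr A P) (re_tr (comm A K) P) (re_tr A (_ + _)) (re_tr A (K * P * K)) (re_tr A (_ - _))
  (re_tr A (K * K * P * (K * K))) => p x a1 a2 a3 a4.
have -> : p + s * x + k s * a1 - s ^+ 2 * a2 + s * k s * a3 + k s ^+ 2 * a4 - p - s * x =
   k s * a1 - s ^+ 2 * a2 + s * k s * a3 + k s ^+ 2 * a4 by ring.
move: (k s) k0 ks => q k0 ks.
have t1 : `|q * a1| <= s ^+ 2 * `|a1| by rewrite normrM ger0_norm // ler_wpM2r.
have t2 : `|s ^+ 2 * a2| <= s ^+ 2 * `|a2| by rewrite normrM ger0_norm // sqr_ge0.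
have t3 : `|s * q * a3| <= s ^+ 2 * `|a3|.
  rewrite normrM ger0_norm ?mulr_ge0 // ler_wpM2r //.
  by apply: le_trans ks; rewrite ler_piMl.
have t4 : `|q ^+ 2 * a4| <= s ^+ 2 * `|a4|.
  rewrite normrM ger0_norm ?sqr_ge0 // ler_wpM2r //.
  by rewrite lerXn2r ?nnegrE // (le_trans ks) // expr2 ler_piMl.
apply: le_trans (ler_normD _ _) _; rewrite !mulrDr lerD //.
apply: le_trans (ler_normD _ _) _; rewrite lerD //.
by apply: le_trans (ler_normB _ _) _; rewrite lerD.
Qed.

End rot.

(** * Measurability and joint laws of random matrices *)

(** A generated sigma-algebra is a measurable type only over a pointed type. *)
HB.instance Definition _ (R : realType) := isPointed.Build R[i] 0.

Section admissible.
Variables (R : realType) (U : Type).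
Local Notation C := R[i].

(** Measurability, alone or together with boundedness, passes to polynomial
    expressions in matrix entries; the closure lemmas are stated once for both. *)
Definition ring_closed (adm : (U -> R) -> Prop) :=
  [/\ forall c, adm (fun=> c),
      forall f g, adm f -> adm g -> adm (fun x => f x + g x) &
      forall f g, adm f -> adm g -> adm (fun x => f x * g x)].

Variable adm : (U -> R) -> Prop.
Hypothesis admP : ring_closed adm.

Lemma adm_cst c : adm (fun=> c). Proof. by case: admP => h _ _; apply: h. Qed.
Lemma adm_add f g : adm f -> adm g -> adm (fun x => f x + g x).
Proof. by case: admP => _ h _; apply: h. Qed.
Lemma adm_mul f g : adm f -> adm g -> adm (fun x => f x * g x).
Proof. by case: admP => _ _ h; apply: h. Qed.

Lemma adm_opp f : adm f -> adm (fun x => - f x).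
Proof.
move=> hf; rewrite (_ : (fun x => _) = fun x => -1 * f x).
  by apply: adm_mul => //; exact: adm_cst.
by apply/funext => x; rewrite mulN1r.
Qed.

Lemma adm_sub f g : adm f -> adm g -> adm (fun x => f x - g x).
Proof. by move=> hf hg; apply: adm_add => //; exact: adm_opp. Qed.

Lemma adm_exp f k : adm f -> adm (fun x => f x ^+ k).
Proof.
move=> hf; elim: k => [|k IH]; first exact: adm_cst.
by rewrite (_ : (fun x => _) = fun x => f x * f x ^+ k); [exact: adm_mul|apply/funext => x; rewrite exprS].
Qed.

Lemma adm_sum (I : Type) (r : seq I) (F : I -> U -> R) :
  (forall i, adm (F i)) -> adm (fun x => \sum_(i <- r) F i x).
Proof.
move=> h; elim: r => [|i r IH].
  by rewrite (_ : (fun x => _) = fun=> 0); [exact: adm_cst|apply/funext => x; rewrite big_nil].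
rewrite (_ : (fun x => _) = fun x => F i x + \sum_(j <- r) F j x); first exact: adm_add.
by apply/funext => x; rewrite big_cons.
Qed.

Definition adm_cplx (f : U -> C) :=
  adm (fun x => complex.Re (f x)) /\ adm (fun x => complex.Im (f x)).

Lemma adm_cplx_cst c : adm_cplx (fun=> c).
Proof. by split; exact: adm_cst. Qed.

Lemma adm_cplx_real f : adm f -> adm_cplx (fun x => (f x)%:C).
Proof. by move=> h; split => //=; exact: adm_cst. Qed.

Lemma adm_cplx_add f g : adm_cplx f -> adm_cplx g -> adm_cplx (fun x => f x + g x).
Proof.
move=> [f1 f2] [g1 g2]; split.
  rewrite (_ : (fun x => _) = fun x => complex.Re (f x) + complex.Re (g x)); first exact: adm_add.
  by apply/funext => x; rewrite ReD.
rewrite (_ : (fun x => _) = fun x => complex.Im (f x) + complex.Im (g x)); first exact: adm_add.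
by apply/funext => x; case: (f x); case: (g x).
Qed.

Lemma adm_cplx_mul f g : adm_cplx f -> adm_cplx g -> adm_cplx (fun x => f x * g x).
Proof.
move=> [f1 f2] [g1 g2]; split.
  rewrite (_ : (fun x => _) = fun x => complex.Re (f x) * complex.Re (g x) -
     complex.Im (f x) * complex.Im (g x)); first by apply: adm_sub; exact: adm_mul.
  by apply/funext => x; case: (f x); case: (g x).
rewrite (_ : (fun x => _) = fun x => complex.Re (f x) * complex.Im (g x) +
   complex.Im (f x) * complex.Re (g x)); first by apply: adm_add; exact: adm_mul.
by apply/funext => x; case: (f x); case: (g x).
Qed.

Lemma adm_cplx_sum (I : Type) (r : seq I) (F : I -> U -> C) :
  (forall i, adm_cplx (F i)) -> adm_cplx (fun x => \sum_(i <- r) F i x).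
Proof.
move=> h; elim: r => [|i r IH].
  by rewrite (_ : (fun x => _) = fun=> 0); [exact: adm_cplx_cst|apply/funext => x; rewrite big_nil].
rewrite (_ : (fun x => _) = fun x => F i x + \sum_(j <- r) F j x); first exact: adm_cplx_add.
by apply/funext => x; rewrite big_cons.
Qed.

Definition adm_mx (m n : nat) (M : U -> 'M[C]_(m, n)) := forall i j, adm_cplx (fun x => M x i j).

Lemma adm_mx_cst m n (A : 'M[C]_(m, n)) : adm_mx (fun=> A).
Proof. by move=> i j; exact: adm_cplx_cst. Qed.

Lemma adm_mx_add m n (A B : U -> 'M[C]_(m, n)) : adm_mx A -> adm_mx B -> adm_mx (fun x => A x + B x).
Proof.
move=> hA hB i j; rewrite (_ : (fun x => _) = fun x => A x i j + B x i j); first exact: adm_cplx_add.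
by apply/funext => x; rewrite mxE.
Qed.

Lemma adm_mx_scale m n (f : U -> C) (A : U -> 'M[C]_(m, n)) :
  adm_cplx f -> adm_mx A -> adm_mx (fun x => f x *: A x).
Proof.
move=> hf hA i j; rewrite (_ : (fun x => _) = fun x => f x * A x i j); first exact: adm_cplx_mul.
by apply/funext => x; rewrite mxE.
Qed.

Lemma adm_mx_opp m n (A : U -> 'M[C]_(m, n)) : adm_mx A -> adm_mx (fun x => - A x).
Proof.
move=> hA; rewrite (_ : (fun x => _) = fun x => (-1) *: A x).
  by apply: adm_mx_scale => //; exact: adm_cplx_cst.
by apply/funext => x; rewrite scaleN1r.
Qed.

Lemma adm_mx_sub m n (A B : U -> 'M[C]_(m, n)) : adm_mx A -> adm_mx B -> adm_mx (fun x => A x - B x).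
Proof. by move=> hA hB; apply: adm_mx_add => //; exact: adm_mx_opp. Qed.

Lemma adm_mx_mulmx m n p (A : U -> 'M[C]_(m, n)) (B : U -> 'M[C]_(n, p)) :
  adm_mx A -> adm_mx B -> adm_mx (fun x => A x *m B x).
Proof.
move=> hA hB i j; rewrite (_ : (fun x => _) = fun x => \sum_k A x i k * B x k j).
  by apply: adm_cplx_sum => k; exact: adm_cplx_mul.
by apply/funext => x; rewrite mxE.
Qed.

Lemma adm_mx_mul n (A B : U -> 'M[C]_n.+1) : adm_mx A -> adm_mx B -> adm_mx (fun x => A x * B x).
Proof. exact: adm_mx_mulmx. Qed.

Lemma adm_mx_trmx m n (A : U -> 'M[C]_(m, n)) : adm_mx A -> adm_mx (fun x => (A x)^T).
Proof.
move=> hA i j; rewrite (_ : (fun x => _) = fun x => A x j i); first exact: hA.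
by apply/funext => x; rewrite mxE.
Qed.

Lemma adm_mx_exp n (A : U -> 'M[C]_n.+1) k : adm_mx A -> adm_mx (fun x => A x ^+ k).
Proof.
move=> hA; elim: k => [|k IH]; first exact: adm_mx_cst.
rewrite (_ : (fun x => _) = fun x => A x * A x ^+ k); first exact: adm_mx_mul.
by apply/funext => x; rewrite exprS.
Qed.

Lemma adm_cplx_tr n (A : U -> 'M[C]_n) : adm_mx A -> adm_cplx (fun x => \tr (A x)).
Proof. by move=> hA; apply: adm_cplx_sum => i; exact: hA. Qed.

Lemma adm_mx_scalar n (f : U -> C) : adm_cplx f -> adm_mx (fun x => (f x)%:M : 'M[C]_n).
Proof.
move=> hf; rewrite (_ : (fun x => _) = fun x => f x *: (1%:M : 'M[C]_n)).
  by apply: adm_mx_scale => //; exact: adm_mx_cst.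
by apply/funext => x; rewrite scalemx1.
Qed.

Lemma adm_re_tr n (A P : U -> 'M[C]_n.+1) : adm_mx A -> adm_mx P ->
  adm (fun x => re_tr (A x) (P x)).
Proof. by move=> hA hP; have [] := adm_cplx_tr (adm_mx_mul hA hP). Qed.

Lemma adm_mx_comm n (A : U -> 'M[C]_n.+1) K : adm_mx A -> adm_mx (fun x => comm (A x) K).
Proof.
by move=> hA; apply: adm_mx_sub; apply: adm_mx_mul => //; exact: adm_mx_cst.
Qed.
End admissible.

Section mx_measurable.
Variable R : realType.
Local Notation C := R[i].

Lemma measurable_closed d (U : measurableType d) :
  ring_closed (fun f : U -> R => measurable_fun setT f).
Proof.
split=> [c|f g hf hg|f g hf hg]; first exact: measurable_cst.
  exact: measurable_funD.
exact: measurable_funM.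
Qed.

Definition mxspace n := g_sigma_algebraType (@mx_cylinder R n).

Definition measurable_mx d (U : measurableType d) m n (M : U -> 'M[C]_(m, n)) :=
  adm_mx (fun f : U -> R => measurable_fun setT f) M.

Lemma measurable_mx_id n : measurable_mx (fun M : mxspace n => M : 'M[C]_n).
Proof.
move=> i j; split=> _ B mB; rewrite setTI; apply: sub_sigma_algebra; exists i, j, B; split=> //.
  by left.
by right.
Qed.

Lemma measurable_mxP d (U : measurableType d) n (M : U -> 'M[C]_n) :
  measurable_mx M <-> measurable_fun setT (M : U -> mxspace n).
Proof.
split=> [hM|hM i j].
  apply: (@measurability _ _ U (mxspace n) setT M (@mx_cylinder R n)) => //.
  move=> _ [B [i [j [A [mA hB]]]] <-].
  have [hr hi] := hM i j.
  case: hB => ->; [have := hr measurableT A mA | have := hi measurableT A mA]; exact.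
have [h1 h2] := measurable_mx_id i j.
by split; [apply: (measurableT_comp h1) | apply: (measurableT_comp h2)].
Qed.

Lemma measurable_mx_comp d (U : measurableType d) d' (V : measurableType d') m n
  (M : V -> 'M[C]_(m, n)) (f : U -> V) :
  measurable_mx M -> measurable_fun setT f -> measurable_mx (fun x => M (f x)).
Proof.
move=> hM hf i j; have [h1 h2] := hM i j.
by split; [apply: (measurableT_comp h1) | apply: (measurableT_comp h2)].
Qed.
End mx_measurable.

Section joint_law.
Context (d : measure_display) (T : measurableType d) (R : realType).
Variable Pr : probability T R.
Variable n : nat.
Local Notation C := R[i].
Local Notation Mx := (mxspace R n).

Lemma random_matrixP (X : T -> 'M[C]_n) :
  random_matrix X <-> measurable_fun setT (X : T -> Mx).
Proof.
split=> [hX _ B mB|hX B mB]; first by rewrite setTI; exact: hX.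
by have := hX measurableT B mB; rewrite setTI.
Qed.

(** By independence the two joint laws agree on rectangles, which generate the
    product sigma-algebra and are stable under intersection. *)
Lemma same_joint_law (X X' P P' : T -> 'M[C]_n) :
  random_matrix X -> random_matrix X' -> random_matrix P -> random_matrix P' ->
  independent_matrices Pr X P -> independent_matrices Pr X' P' ->
  (forall B, mx_measurable B -> Pr (X @^-1` B) = Pr (X' @^-1` B)) ->
  (forall B, mx_measurable B -> Pr (P @^-1` B) = Pr (P' @^-1` B)) ->
  forall F : Mx * Mx -> R, measurable_fun setT F ->
  Pr.-integrable setT (EFin \o (fun w => F (X w, P w))) ->
  Pr.-integrable setT (EFin \o (fun w => F (X' w, P' w))) ->
  \int[Pr]_w F (X w, P w) = \int[Pr]_w F (X' w, P' w).
Proof.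
move=> /random_matrixP mX /random_matrixP mX' /random_matrixP mP /random_matrixP mP'.
move=> iXP iXP' eX eP F mF i1 i2.
pose Z w : Mx * Mx := (X w, P w); pose Z' w : Mx * Mx := (X' w, P' w).
have mZ : measurable_fun setT Z by exact: measurable_fun_pair.
have mZ' : measurable_fun setT Z' by exact: measurable_fun_pair.
have mEF : measurable_fun setT (EFin \o F) by exact: measurableT_comp.
have law A : measurable A -> pushforward Pr Z A = pushforward Pr Z' A.
  pose G : set (set (Mx * Mx)) := [set A `*` B | A in measurable & B in measurable].
  apply: (measure_unique G (fun=> setT)).
  - exact: measurable_prod_measurableType.
  - move=> _ _ [A1 mA1 [A2 mA2 <-]] [B1 mB1 [B2 mB2 <-]].
    exists (A1 `&` B1); first exact: measurableI.
    by exists (A2 `&` B2); [exact: measurableI|rewrite setXI].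
  - by move=> _; exists setT => //; exists setT => //; rewrite setXTT.
  - by rewrite bigcup_const.
  - move=> _ [A1 mA1 [A2 mA2 <-]]; rewrite /pushforward.
    have h1 := iXP _ _ mA1 mA2; have h2 := iXP' _ _ mA1 mA2.
    by rewrite eX // eP // -h2 in h1.
  - move=> _; rewrite /= /pushforward; have -> : Z @^-1` setT = setT by [].
    by rewrite (@probability_setT _ _ _ Pr) ltry.
congr fine.
rewrite -[LHS](integral_pushforward mZ mEF i1 measurableT).
rewrite -[RHS](integral_pushforward mZ' mEF i2 measurableT).
by apply: eq_measure_integral => A mA _; exact: law.
Qed.
End joint_law.

(** * Expectations and first order expansions *)

Lemma probability_inhabited d (T : measurableType d) (R : realType) (Pr : probability T R) :
  inhabited T.
Proof.
apply: contrapT => h; have := @probability_setT _ _ _ Pr.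
rewrite (_ : setT = set0) ?measure0 ?predeqE; last by move=> w; split=> // _; apply: h; exists.
by move=> /eqP; rewrite eq_sym onee_eq0.
Qed.

Section bounded_measurable.
Context (d : measure_display) (T : measurableType d) (R : realType).
Variable Pr : probability T R.

Definition bounded_rv (f : T -> R) := measurable_fun setT f /\ exists c, forall w, `|f w| <= c.

Lemma bounded_rv_closed : ring_closed bounded_rv.
Proof.
have [mc ma mm] := measurable_closed R T.
split=> [c|f g [mf [cf hf]] [mg [cg hg]]|f g [mf [cf hf]] [mg [cg hg]]].
- by split; [exact: mc|exists `|c|].
- split; first exact: ma.
  by exists (cf + cg) => w; apply: le_trans (ler_normD _ _) _; rewrite lerD.
- split; first exact: mm.
  by exists (cf * cg) => w; rewrite normrM ler_pM.
Qed.

Lemma prob_lty : (Pr setT < +oo)%E.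
Proof. by rewrite (@probability_setT _ _ _ Pr) ltry. Qed.

Lemma bounded_rv_integrable f : bounded_rv f -> Pr.-integrable setT (EFin \o f).
Proof.
move=> [mf [c hc]]; apply: measurable_bounded_integrable => //; first exact: prob_lty.
exists c; split; first exact: num_real.
by move=> M M1 t _; rewrite /= (le_trans (hc t)) // ltW.
Qed.

Definition expect (f : T -> R) : R := \int[Pr]_w f w.

Lemma expectD f g : bounded_rv f -> bounded_rv g -> expect (fun w => f w + g w) = expect f + expect g.
Proof. by move=> /bounded_rv_integrable hf /bounded_rv_integrable hg; exact: RintegralD. Qed.

Lemma expectZ c f : bounded_rv f -> expect (fun w => c * f w) = c * expect f.
Proof. by move=> /bounded_rv_integrable hf; exact: RintegralZl. Qed.

Lemma expect_cst c : expect (fun=> c) = c.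
Proof.
rewrite /expect Rintegral_cst // -[RHS]mulr1; congr (_ * _).
have h : (Pr setT = 1)%E by exact: (@probability_setT _ _ _ Pr).
by transitivity (fine (Pr setT)); last rewrite h.
Qed.

Lemma expectB f g : bounded_rv f -> bounded_rv g -> expect (fun w => f w - g w) = expect f - expect g.
Proof. by move=> /bounded_rv_integrable hf /bounded_rv_integrable hg; exact: RintegralB. Qed.

Lemma expect_le f g : bounded_rv f -> bounded_rv g -> (forall w, f w <= g w) -> expect f <= expect g.
Proof.
move=> hf hg h; rewrite -subr_ge0 -expectB //.
by apply: Rintegral_ge0 => w _; rewrite subr_ge0.
Qed.

Lemma expect_abs_le f c : bounded_rv f -> (forall w, `|f w| <= c) -> `|expect f| <= c.
Proof.
move=> hf h; have hc := adm_cst bounded_rv_closed.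
rewrite ler_norml -[c in - c]opprK; apply/andP; split.
  by rewrite opprK -[- c]expect_cst expect_le // => w; have := h w; rewrite ler_norml => /andP[].
by rewrite -[c]expect_cst expect_le // => w; have := h w; rewrite ler_norml => /andP[].
Qed.

Lemma expect_sum (I : Type) (r : seq I) (F : I -> T -> R) : (forall i, bounded_rv (F i)) ->
  expect (fun w => \sum_(i <- r) F i w) = \sum_(i <- r) expect (F i).
Proof.
move=> h; elim: r => [|i r IH].
  rewrite big_nil -[RHS]expect_cst; congr expect; apply/funext => w.
  by rewrite big_nil.
rewrite big_cons -IH -expectD //; last exact: (adm_sum bounded_rv_closed).
by congr expect; apply/funext => w; rewrite big_cons.
Qed.

(** The error is uniform in the random element, so that expectations inherit the
    expansion. *)
Definition expands1 (f : R -> T -> R) (f0 f1 : T -> R) :=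
  [/\ forall s, bounded_rv (f s), bounded_rv f0, bounded_rv f1 &
   exists2 c, 0 <= c & forall s w, 0 <= s <= 1 -> `|f s w - f0 w - s * f1 w| <= c * s ^+ 2].

Lemma expands1M f f0 f1 g g0 g1 : expands1 f f0 f1 -> expands1 g g0 g1 ->
  expands1 (fun s w => f s w * g s w) (fun w => f0 w * g0 w)
    (fun w => f1 w * g0 w + f0 w * g1 w).
Proof.
move=> [bf bf0 bf1 [c c0 hc]] [bg bg0 bg1 [e e0 he]].
have mulc := adm_mul bounded_rv_closed; have addc := adm_add bounded_rv_closed.
split=> [s|||]; [exact: mulc|exact: mulc|by apply: addc; exact: mulc|].
have [_ [Cf0 hf0]] := bf0; have [_ [Cf1 hf1]] := bf1.
have [_ [Cg0 hg0]] := bg0; have [_ [Cg1 hg1]] := bg1.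
have [w0] := probability_inhabited Pr.
have Cf0p : 0 <= Cf0 := le_trans (normr_ge0 _) (hf0 w0).
have Cf1p : 0 <= Cf1 := le_trans (normr_ge0 _) (hf1 w0).
have Cg0p : 0 <= Cg0 := le_trans (normr_ge0 _) (hg0 w0).
have Cg1p : 0 <= Cg1 := le_trans (normr_ge0 _) (hg1 w0).
exists (c * (Cg0 + Cg1 + e) + (Cf0 + Cf1) * e + Cf1 * Cg1).
  by rewrite !addr_ge0 ?mulr_ge0 ?addr_ge0.
move=> s w s01; have := hc s w s01; have := he s w s01; case/andP: s01 => s0 s1.
move: (hf0 w) (hf1 w) (hg0 w) (hg1 w).
move: (f s w) (g s w) (f0 w) (f1 w) (g0 w) (g1 w) => a b a0 a1 b0 b1.
move=> h1 h2 h3 h4; set rb := b - b0 - s * b1; set ra := a - a0 - s * a1 => h5 h6.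
have -> : a * b - a0 * b0 - s * (a1 * b0 + a0 * b1) =
   ra * b + (a0 + s * a1) * rb + s ^+ 2 * (a1 * b1) by rewrite /ra /rb; ring.
have s2 : 0 <= s ^+ 2 := sqr_ge0 s.
have s21 : s ^+ 2 <= 1 by rewrite expr_le1.
have small x Cx : `|x| <= Cx -> `|s * x| <= Cx.
  move=> hx; rewrite normrM (ger0_norm s0); apply: le_trans hx.
  by rewrite ler_piMl.
have hb : `|b| <= Cg0 + Cg1 + e.
  have -> : b = b0 + s * b1 + rb by rewrite /rb; ring.
  apply: le_trans (ler_normD _ _) _; apply: lerD.
    by apply: le_trans (ler_normD _ _) _; apply: lerD => //; exact: small.
  by apply: le_trans h5 _; rewrite ler_piMr.
have ha : `|a0 + s * a1| <= Cf0 + Cf1.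
  by apply: le_trans (ler_normD _ _) _; apply: lerD => //; exact: small.
apply: le_trans (ler_normD _ _) _.
rewrite [leRHS]mulrDl; apply: lerD; last first.
  by rewrite normrM ger0_norm // [leRHS]mulrC ler_wpM2l // normrM ler_pM.
apply: le_trans (ler_normD _ _) _; rewrite [leRHS]mulrDl; apply: lerD.
  rewrite normrM; apply: (@le_trans _ _ (c * s ^+ 2 * (Cg0 + Cg1 + e))).
    by rewrite ler_pM.
  by rewrite mulrAC.
by rewrite normrM -[leRHS]mulrA ler_pM.
Qed.

Lemma expands1X f f0 f1 m : expands1 f f0 f1 ->
  expands1 (fun s w => f s w ^+ m.+1) (fun w => f0 w ^+ m.+1)
    (fun w => m.+1%:R * f0 w ^+ m * f1 w).
Proof.
move=> h; elim: m => [|m IH].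
  by under [X in expands1 _ _ X]eq_fun do rewrite expr0 mul1r mul1r.
have := expands1M h IH.
rewrite (_ : (fun s w => f s w * _) = (fun s w => f s w ^+ m.+2)); last first.
  by apply/funext => s; apply/funext => w; rewrite [RHS]exprS.
rewrite (_ : (fun w => f0 w * _) = (fun w => f0 w ^+ m.+2)); last first.
  by apply/funext => w; rewrite [RHS]exprS.
congr expands1; apply/funext => w.
rewrite -[m.+2%:R]natr1 [f0 w ^+ m.+1]exprS; ring.
Qed.

(** [s * E f1] is the expectation of an error of order [s ^+ 2]; divide by [s]. *)
Lemma expands1_expect f f0 f1 : expands1 f f0 f1 ->
  (forall s, 0 <= s <= 1 -> expect (f s) = expect f0) -> expect f1 = 0.
Proof.
move=> [bf bf0 bf1 [c c0 hc]] h.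
have addc := adm_add bounded_rv_closed; have mulc := adm_mul bounded_rv_closed.
have cstc := adm_cst bounded_rv_closed; have subc := adm_sub bounded_rv_closed.
have key s : 0 < s <= 1 -> `|expect f1| <= c * s.
  move=> /andP[s0 s1]; have s01 : 0 <= s <= 1 by rewrite ltW.
  rewrite -(ler_pM2l s0) -[s in s * `|_|](ger0_norm (ltW s0)) -normrM.
  have -> : s * expect f1 = - expect (fun w => f s w - f0 w - s * f1 w).
    rewrite expectB; [|by apply: subc|by apply: mulc].
    by rewrite expectB // h // subrr sub0r opprK expectZ.
  rewrite normrN mulrCA -expr2; apply: expect_abs_le => [|w]; last exact: hc.
  by apply: (subc); [exact: subc|exact: mulc].
apply/eqP; rewrite -normr_le0 leNgt; apply/negP => p.
have c1 : 0 < c + 1 by rewrite ltr_wpDl.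
pose s := Num.min 1 (`|expect f1| / 2 / (c + 1)).
have sp : 0 < s by rewrite lt_min ltr01 !divr_gt0.
have := key s; rewrite sp ge_min lexx => /(_ isT).
have s2 : s <= `|expect f1| / 2 / (c + 1) by rewrite ge_min lexx orbT.
have : c * s <= `|expect f1| / 2.
  apply: (@le_trans _ _ ((c + 1) * s)); first by rewrite ler_wpM2r ?ltW // ltrDl.
  by rewrite mulrC -ler_pdivlMr.
lra.
Qed.
End bounded_measurable.

(** * Rotation invariance and integration by parts *)

Section rot_real.
Variables (R : realType) (n : nat).
Local Notation C := R[i].
Local Notation M := 'M[C]_n.+1.

Lemma conjR (r : R) : Num.conj (r%:C : C) = r%:C.
Proof. by rewrite -[LHS]/(conjc _) conjc_real. Qed.

Lemma map_conjZ (r : R) (A : M) :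
  map_mx Num.conj (r%:C *: A) = r%:C *: map_mx Num.conj A.
Proof. by apply/matrixP => i j; rewrite !mxE rmorphM; congr (_ * _); exact: conjR. Qed.

Lemma rot_real i j s : rot (plane_gen R i j : M) s ^ Num.conj = rot (plane_gen R i j) s.
Proof.
by rewrite /rot !map_mxD !map_conjZ map_mx1 -mulmxE map_mxM plane_gen_real.
Qed.

Lemma rot_trmx i j s : (rot (plane_gen R i j : M) s)^T = (rot (plane_gen R i j) s)^t*.
Proof. by rewrite -map_trmx rot_real. Qed.

Lemma rot_over_scalars sc i j s : over_scalars sc (rot (plane_gen R i j : M) s).
Proof.
case: sc => //=; apply/mxOverP => a b; apply/CrealP.
by have /matrixP /(_ a b) := rot_real i j s; rewrite mxE.
Qed.

Lemma rot_is_unitary i j s : 0 <= s <= 1 -> rot (plane_gen R i j : M) s \is unitarymx.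
Proof.
move=> hs; apply/unitarymxP; rewrite mulmxE.
exact: (rot_unitary (plane_gen_adj R i j) (plane_gen_cube R i j) hs).
Qed.
End rot_real.

Section concentration.
Context (d : measure_display) (T : measurableType d) (R : realType).
Variable Pr : probability T R.
Variable n : nat.
Local Notation C := R[i].
Local Notation M := 'M[C]_n.+1.
Local Notation Mx := (mxspace R n.+1).
Local Notation "''E'" := (expect Pr).

Definition rot_equivariant (A : M -> M) := forall i j s x, 0 <= s <= 1 ->
  let U := rot (plane_gen R i j) s in A (U * x * U^t*) = U * A x * U^t*.

Lemma adm_mx_bounded (A : T -> M) (c : R) : measurable_mx A ->
  (forall w i j, sqmod (A w i j) <= c) -> adm_mx (@bounded_rv d T R) A.
Proof.
move=> mA hc i j; have [h1 h2] := mA i j.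
have h w : `|complex.Re (A w i j)| <= Num.sqrt c /\ `|complex.Im (A w i j)| <= Num.sqrt c.
  split; rewrite -sqrtr_sqr ler_wsqrtr //; apply: le_trans (hc w i j);
  by rewrite /sqmod ?lerDl ?lerDr sqr_ge0.
by split; split => //; exists (Num.sqrt c) => w; have [] := h w.
Qed.

Lemma random_conj (P : T -> M) (U : M) : random_matrix P ->
  random_matrix (fun w => U * P w * U^t*).
Proof.
move=> /random_matrixP/measurable_mxP mP; apply/random_matrixP/measurable_mxP.
have cl := measurable_closed R T.
by apply: (adm_mx_mul cl); [apply: (adm_mx_mul cl) => //|]; exact: (adm_mx_cst cl).
Qed.

Lemma mx_measurable_conj (U : M) (B : set M) : mx_measurable B ->
  mx_measurable ((fun x => U * x * U^t*) @^-1` B).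
Proof.
move=> mB; have : measurable_fun setT ((fun x : Mx => U * (x : M) * U^t*) : Mx -> Mx).
  apply/measurable_mxP; have cl := measurable_closed R Mx.
  apply: (adm_mx_mul cl); last exact: (adm_mx_cst cl).
  by apply: (adm_mx_mul cl); [exact: (adm_mx_cst cl)|exact: measurable_mx_id].
by move=> /(_ measurableT B mB); rewrite setTI.
Qed.

Variables (s0 : symmetry_class) (X P : T -> M).
Hypothesis X_random : random_matrix X.
Hypothesis P_random : random_matrix P.
Hypothesis XP_indep : independent_matrices Pr X P.
Hypothesis XP_inv : conj_invariant Pr s0 X \/ conj_invariant Pr s0 P.

Variables (A B : M -> M).
Hypothesis mA : measurable_mx (A : Mx -> M).
Hypothesis mB : measurable_mx (B : Mx -> M).
Hypothesis eA : rot_equivariant A.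
Hypothesis eB : rot_equivariant B.
Hypothesis bA : adm_mx (@bounded_rv d T R) (fun w => A (X w)).
Hypothesis bB : adm_mx (@bounded_rv d T R) (fun w => B (X w)).
Hypothesis bP : adm_mx (@bounded_rv d T R) P.

Let cl := @bounded_rv_closed d T R.

Lemma bounded_rv_conj (U : M) : adm_mx (@bounded_rv d T R) (fun w => U * P w * U^t*).
Proof. by apply: (adm_mx_mul cl); [apply: (adm_mx_mul cl) => //|]; exact: (adm_mx_cst cl). Qed.

Lemma bounded_rv_poly (Q : T -> M) K m : adm_mx (@bounded_rv d T R) Q ->
  bounded_rv (fun w => re_tr (comm (B (X w)) K) (Q w) * re_tr (A (X w)) (Q w) ^+ m).
Proof.
move=> bQ; apply: (adm_mul cl).
  by apply: (adm_re_tr cl) => //; exact: (adm_mx_comm cl).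
by apply: (adm_exp cl); exact: (adm_re_tr cl).
Qed.

(** If the law of [P] is invariant, rotating [P] preserves the joint law. If the law
    of [X] is, equivariance of [A] and [B] first moves the rotation from [P] to [X];
    the generator [K] is not affected, as it commutes with its own rotation. *)
Lemma rot_invariance i j s m : 0 <= s <= 1 ->
  let K := plane_gen R i j in let U := rot K s in
  'E (fun w => re_tr (comm (B (X w)) K) (U * P w * U^t*) *
               re_tr (A (X w)) (U * P w * U^t*) ^+ m) =
  'E (fun w => re_tr (comm (B (X w)) K) (P w) * re_tr (A (X w)) (P w) ^+ m).
Proof.
move=> s01 K U.
have UU : U^t* * U = 1 by exact: (rot_mulV (plane_gen_adj R i j) (plane_gen_cube R i j)).
have UU' : U * U^t* = 1 by exact: (rot_unitary (plane_gen_adj R i j) (plane_gen_cube R i j)).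
have uU : U \is unitarymx by exact: rot_is_unitary.
pose F (z : Mx * Mx) : R := re_tr (comm (B z.1) K) z.2 * re_tr (A z.1) z.2 ^+ m.
have mF : measurable_fun setT F.
  have cM := measurable_closed R (Mx * Mx)%type.
  have m1 : measurable_mx (fun z : Mx * Mx => A z.1) by apply: (measurable_mx_comp mA); exact: measurable_fst.
  have m2 : measurable_mx (fun z : Mx * Mx => B z.1) by apply: (measurable_mx_comp mB); exact: measurable_fst.
  have m3 : measurable_mx (fun z : Mx * Mx => z.2 : M).
    by apply: (measurable_mx_comp (@measurable_mx_id R n.+1)); exact: measurable_snd.
  apply: (adm_mul cM).
    by apply: (adm_re_tr cM) => //; exact: (adm_mx_comm cM).
  by apply: (adm_exp cM); exact: (adm_re_tr cM).
have i0 : Pr.-integrable setT (EFin \o (fun w => F (X w, P w))).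
  by apply: bounded_rv_integrable; exact: bounded_rv_poly.
have i1 : Pr.-integrable setT (EFin \o (fun w => F (X w, U * P w * U^t*))).
  by apply: bounded_rv_integrable; apply: bounded_rv_poly; exact: bounded_rv_conj.
have [Xinv|Pinv] := XP_inv; last first.
  apply: (@same_joint_law _ _ _ Pr _ X X (fun w => U * P w * U^t*) P _ _ _ _ _ _ _ _ F) => //.
  - exact: random_conj.
  - move=> S1 S2 mS1 mS2; have := XP_indep mS1 (mx_measurable_conj U mS2).
    exact.
  - by move=> S mS; apply: (Pinv U) => //; exact: rot_over_scalars.
pose V := U^t*.
have VE : V^t* = U by exact: trmxCK.
have uV : V \is unitarymx by rewrite /V trmxC_unitary.
have oV : over_scalars s0 V by rewrite /V (rot_adj (plane_gen_adj R i j)); exact: rot_over_scalars.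
have jF x p : F (x, U * p * U^t*) = F (V * x * V^t*, p).
  rewrite VE; set y := V * x * U.
  have -> : x = U * y * U^t*.
    by rewrite /y /V !mulrA UU' mul1r -mulrA UU' mulr1.
  rewrite /F /= (eA _ _ _ s01) (eB _ _ _ s01) -/U.
  rewrite (comm_rot (plane_gen_adj R i j) _ s01).
  by rewrite !re_tr_conj.
transitivity ('E (fun w => F (V * X w * V^t*, P w))).
  by congr expect; apply/funext => w; exact: jF.
apply: (@same_joint_law _ _ _ Pr _ (fun w => V * X w * V^t*) X P P _ _ _ _ _ _ _ _ F) => //.
- exact: random_conj.
- move=> S1 S2 mS1 mS2; have := XP_indep (mx_measurable_conj V mS1) mS2.
  exact.
- by move=> S mS; exact: (Xinv V uV oV S mS).
- by move: i1; congr (_.-integrable _ _); apply/funext => w /=; rewrite jF.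
Qed.

(** The derivative at [s = 0] of the constant function in [rot_invariance]. *)
Lemma stein_rot i j m : let K := plane_gen R i j in
  'E (fun w => re_tr (comm (comm (B (X w)) K) K) (P w) * re_tr (A (X w)) (P w) ^+ m.+1 +
     re_tr (comm (B (X w)) K) (P w) *
       (m.+1%:R * re_tr (A (X w)) (P w) ^+ m * re_tr (comm (A (X w)) K) (P w))) = 0.
Proof.
move=> K.
have ex (D : T -> M) : adm_mx (@bounded_rv d T R) D ->
    expands1 (fun s w => re_tr (D w) (rot K s * P w * (rot K s)^t*))
      (fun w => re_tr (D w) (P w)) (fun w => re_tr (comm (D w) K) (P w)).
  move=> bD.
  have b1 L L' : bounded_rv (fun w => re_tr (D w) (L * P w * L')).
    apply: (adm_re_tr cl) => //.
    by apply: (adm_mx_mul cl); [apply: (adm_mx_mul cl) => //|]; exact: (adm_mx_cst cl).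
  split.
  - by move=> s; exact: b1.
  - exact: (adm_re_tr cl).
  - by apply: (adm_re_tr cl) => //; exact: (adm_mx_comm cl).
  have [_ [c1 h1]] := b1 (K * K) 1; have [_ [c2 h2]] := b1 1 (K * K).
  have [_ [c3 h3]] := b1 K K; have [_ [c4 h4]] := b1 K (K * K).
  have [_ [c5 h5]] := b1 (K * K) K; have [_ [c6 h6]] := b1 (K * K) (K * K).
  exists (`|(c1 + c2) + c3 + (c4 + c5) + c6|) => // s w s01.
  apply: le_trans (re_tr_rot_taylor (plane_gen_adj R i j) _ _ s01) _.
  rewrite mulrC ler_wpM2r ?sqr_ge0 //; apply: le_trans (ler_norm _).
  apply: lerD; last exact: h6.
  apply: lerD.
    apply: lerD; last exact: h3.
    rewrite re_trD; apply: le_trans (ler_normD _ _) _; apply: lerD.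
      by have := h1 w; rewrite mulr1.
    by have := h2 w; rewrite mul1r.
  rewrite re_trD re_trN; apply: le_trans (ler_normB _ _) _.
  by apply: lerD; [exact: h4|exact: h5].
have e1 := expands1M Pr (ex _ (adm_mx_comm cl K bB)) (expands1X Pr m (ex _ bA)).
apply: (expands1_expect e1) => s s01; exact: rot_invariance.
Qed.
End concentration.

(** * Second and fourth moments *)

Section moments.
Context (d : measure_display) (T : measurableType d) (R : realType).
Variable Pr : probability T R.
Variable n : nat.
Local Notation C := R[i].
Local Notation M := 'M[C]_n.+1.
Local Notation Mx := (mxspace R n.+1).
Local Notation "''E'" := (expect Pr).

Variables (s0 : symmetry_class) (X P : T -> M).
Hypothesis X_random : random_matrix X.
Hypothesis P_random : random_matrix P.
Hypothesis XP_indep : independent_matrices Pr X P.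
Hypothesis XP_inv : conj_invariant Pr s0 X \/ conj_invariant Pr s0 P.
Variable theta : R.
Hypothesis P_rank1 : forall w, exists v : 'rV[C]_n.+1,
  norm2 v = 1 /\ P w = theta%:C *: (v^t* *m v).

Variables (A : M -> M) (c : R).
Hypothesis mA : measurable_mx (A : Mx -> M).
Hypothesis eA : rot_equivariant A.
Hypothesis A_tr : forall w, \tr (A (X w)) = 0.
Hypothesis A_herm : forall w, (A (X w))^t* = A (X w).
Hypothesis A_norm : forall w y, norm2 (y *m A (X w)) <= c * norm2 y.

Let cl := @bounded_rv_closed d T R.
Let S w := re_tr (A (X w)) (P w).
(* the inverse image of a multiple of [A] under the Casimir operator, see [casimir_B] *)
Let B x : M := n%:R *: A x - (A x)^T.

Lemma sqmod_le_norm2 m (y : 'rV[C]_m) j : sqmod (y 0 j) <= norm2 y.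
Proof.
rewrite /norm2 (bigD1 j) //= lerDl sumr_ge0 // => i _; exact: sqmod_ge0.
Qed.

Lemma norm2_conj m (y : 'rV[C]_m) : norm2 (map_mx Num.conj y) = norm2 y.
Proof. by apply: eq_bigr => i _; rewrite mxE sqmod_conj. Qed.

Lemma bounded_A : adm_mx (@bounded_rv d T R) (fun w => A (X w)).
Proof.
apply: (@adm_mx_bounded _ _ _ _ _ c).
  by apply: (measurable_mx_comp mA); apply/random_matrixP.
move=> w i j; have := A_norm w (delta_mx 0 i).
rewrite -rowE; have -> : norm2 (delta_mx 0 i : 'rV[C]_n.+1) = 1.
  rewrite /norm2 (bigD1 i) //= big1 => [|k ki].
    by rewrite mxE !eqxx /sqmod /= expr1n expr0n !addr0.
  by rewrite mxE (negbTE ki) andbF /sqmod /= expr0n addr0.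
rewrite mulr1; apply: le_trans.
by have := sqmod_le_norm2 (row i (A (X w))) j; rewrite mxE.
Qed.

Lemma bounded_P : adm_mx (@bounded_rv d T R) P.
Proof.
apply: (@adm_mx_bounded _ _ _ _ _ (theta ^+ 2)).
  by apply/measurable_mxP; apply/random_matrixP.
move=> w i j; have [v [nv ->]] := P_rank1 w.
rewrite mxE sqmodM sqmodR ler_piMr ?sqr_ge0 // mxE big_ord1 !mxE sqmodM sqmod_conj.
rewrite -[1]mulr1 ler_pM ?sqmod_ge0 // -nv; exact: sqmod_le_norm2.
Qed.

Lemma measurable_B : measurable_mx (B : Mx -> M).
Proof.
have cM := measurable_closed R Mx.
apply: (adm_mx_sub cM); last exact: (adm_mx_trmx mA).
by apply: (adm_mx_scale cM) => //; exact: (adm_cplx_cst cM).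
Qed.

Lemma bounded_B : adm_mx (@bounded_rv d T R) (fun w => B (X w)).
Proof.
apply: (adm_mx_sub cl); last exact: (adm_mx_trmx bounded_A).
by apply: (adm_mx_scale cl); [exact: (adm_cplx_cst cl)|exact: bounded_A].
Qed.

Lemma equivariant_B : rot_equivariant B.
Proof.
move=> i j s x hs U; rewrite /B (eA _ _ _ hs) -/U mulrBr mulrBl.
congr (_ - _); first by rewrite -scalerAr -scalerAl.
have UT : U^T = U^t* by exact: rot_trmx.
have UT' : (U^t*)^T = U by rewrite -UT trmxK.
by rewrite -!mulmxE !trmx_mul UT' [in LHS]UT mulmxA.
Qed.

Lemma bounded_form : bounded_rv S.
Proof. by apply: (adm_re_tr cl); [exact: bounded_A|exact: bounded_P]. Qed.

Lemma casimir_B w : \sum_i \sum_j comm (comm (B (X w)) (plane_gen R i j)) (plane_gen R i j) =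
  - ((4 * (n%:R ^+ 2 - 1))%:C *: A (X w)).
Proof.
rewrite casimir; have -> : \tr (B (X w)) = 0.
  by rewrite /B raddfB /= mxtraceZ mxtrace_tr A_tr mulr0 subr0.
congr (- _); rewrite (_ : (4 * _)%:C = 4 * (n%:R ^+ 2 - 1)); last first.
  by rewrite rmorphM rmorphB rmorphXn /= !(rmorph_nat (real_complex R)).
rewrite /B -scalerA; congr (_ *: _).
by apply/matrixP => a b; rewrite !mxE; case: eqP => _; ring.
Qed.

(** The transpose of a Hermitian matrix is its conjugate, so it obeys the same bound. *)
Lemma norm_B w v : norm2 v = 1 -> norm2 (v *m B (X w)) <= (n.+1)%:R ^+ 2 * c.
Proof.
move=> nv.
have e : v *m (A (X w))^T = map_mx Num.conj (map_mx Num.conj v *m A (X w)).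
  by rewrite map_mxM -map_mx_comp (map_mx_id (@conjCK _)) -[in LHS]A_herm map_trmx trmxK.
have n0 : 0 <= n%:R :> R by [].
have key (x y : C) : sqmod (n%:R * x - y) <= n.+1%:R * (n%:R * sqmod x + sqmod y).
  have -> : (n%:R : C) = n%:R%:C by rewrite (rmorph_nat (real_complex R)).
  rewrite -natr1; move: n%:R n0 => r r0; case: x => x1 x2; case: y => y1 y2.
  rewrite /sqmod /= !mul0r subr0 addr0.
  have := mulr_ge0 r0 (sqr_ge0 (x1 + y1)); have := mulr_ge0 r0 (sqr_ge0 (x2 + y2)).
  nra.
apply: (@le_trans _ _ (n.+1%:R * (n%:R * norm2 (v *m A (X w)) + norm2 (v *m (A (X w))^T)))).
  rewrite /norm2 mulr_sumr -big_split mulr_sumr; apply: ler_sum => j _ /=.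
  by rewrite /B mulmxBr -scalemxAr !mxE; exact: key.
rewrite e norm2_conj expr2 -mulrA ler_wpM2l //.
have h1 := A_norm w v; have h2 := A_norm w (map_mx Num.conj v).
rewrite norm2_conj nv mulr1 in h1 h2.
rewrite -natr1 mulrDl mul1r lerD //; exact: ler_wpM2l.
Qed.

(** Both gradients have the order of the norms of [v *m A] and [v *m B], which differ
    by a factor [n.+1]; weighting the arithmetic-geometric inequality accordingly
    keeps a single factor of the dimension. *)
Lemma cross_bound w :
  \sum_i \sum_j re_tr (comm (B (X w)) (plane_gen R i j)) (P w) *
                re_tr (comm (A (X w)) (plane_gen R i j)) (P w) <= 16 * n.+1%:R * theta ^+ 2 * c.
Proof.
have [v [nv Pv]] := P_rank1 w.
have B_herm : (B (X w))^t* = B (X w).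
  have hh := A_herm w.
  have h2 : (A (X w))^T^t* = (A (X w))^T.
    by rewrite trmxK -[in RHS]hh -map_trmx trmxK.
  apply/matrixP => a b; rewrite /B !mxE rmorphB rmorphM rmorph_nat /=.
  have /matrixP /(_ a b) := hh; have /matrixP /(_ a b) := h2; rewrite !mxE => e2 e1.
  by congr (_ * _ - _).
have gA := grad_bound theta (A_herm w) nv.
have gB := grad_bound theta B_herm nv.
have N0 : 0 < n.+1%:R :> R by rewrite ltr0n.
have t0 := sqr_ge0 theta.
have nB := norm_B w nv.
have nA : norm2 (v *m A (X w)) <= c by have := A_norm w v; rewrite nv mulr1.
rewrite Pv; set N := n.+1%:R in N0 nB *.
apply: (@le_trans _ _ (\sum_i \sum_j
   (2^-1 * (N^-1 * re_tr (comm (B (X w)) (plane_gen R i j)) (theta%:C *: (v^t* *m v)) ^+ 2 +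
    N * re_tr (comm (A (X w)) (plane_gen R i j)) (theta%:C *: (v^t* *m v)) ^+ 2)))).
  apply: ler_sum => i _; apply: ler_sum => j _.
  move: (re_tr (comm (B _) _) _) (re_tr (comm (A _) _) _) => x y.
  rewrite ler_pdivlMl // -(ler_pM2l N0) mulrDr (mulrA N N^-1) divff ?gt_eqF // mul1r.
  rewrite -subr_ge0 (_ : _ - _ = (x - N * y) ^+ 2) ?sqr_ge0 //; ring.
under eq_bigr do rewrite -mulr_sumr big_split /= -!mulr_sumr.
rewrite -mulr_sumr big_split /= -!mulr_sumr.
move: gA gB; rewrite /re_tr; set a := (\sum_i _); set b := (\sum_i _) => gA gB.
have gA' : a <= 16 * theta ^+ 2 * c by apply: le_trans gA _; rewrite ler_wpM2l // mulr_ge0.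
have gB' : N^-1 * b <= 16 * theta ^+ 2 * (N * c).
  rewrite ler_pdivrMl //; apply: le_trans gB _.
  apply: (@le_trans _ _ (16 * theta ^+ 2 * (N ^+ 2 * c))); first by rewrite ler_wpM2l // mulr_ge0.
  by rewrite expr2 le_eqVlt; apply/orP; left; apply/eqP; ring.
have gA'' : N * a <= N * (16 * theta ^+ 2 * c) by rewrite ler_wpM2l // ltW.
have -> : 16 * N * theta ^+ 2 * c =
  2^-1 * (16 * theta ^+ 2 * (N * c) + N * (16 * theta ^+ 2 * c)) by field.
by rewrite ler_wpM2l // lerD.
Qed.

(** Summing [stein_rot] over all planes, the second derivatives of the form of [B]
    give a multiple of [S] of order [n ^+ 2], while the product of the gradients is
    only of order [n]. Each step thus gains a factor of order [n^-1]. *)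
Lemma moment_step m : ~~ odd m -> (2 <= n)%N ->
  (n%:R - 1) * 'E (fun w => S w ^+ m.+2) <= 4 * m.+1%:R * theta ^+ 2 * c * 'E (fun w => S w ^+ m).
Proof.
move=> em n2.
pose G w := \sum_i \sum_j re_tr (comm (B (X w)) (plane_gen R i j)) (P w) *
                re_tr (comm (A (X w)) (plane_gen R i j)) (P w).
have bcomm (D : T -> M) i j : adm_mx (@bounded_rv d T R) D ->
    bounded_rv (fun w => re_tr (comm (D w) (plane_gen R i j)) (P w)).
  by move=> bD; apply: (adm_re_tr cl); [exact: (adm_mx_comm cl)|exact: bounded_P].
have bG : bounded_rv G.
  apply: (adm_sum cl) => i; apply: (adm_sum cl) => j.
  by apply: (adm_mul cl); apply: bcomm; [exact: bounded_B|exact: bounded_A].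
have bSX k : bounded_rv (fun w => S w ^+ k) by apply: (adm_exp cl); exact: bounded_form.
have id : 'E (fun w => (m.+1%:R * (S w ^+ m * G w)) - (4 * (n%:R ^+ 2 - 1)) * S w ^+ m.+2) = 0.
  pose H i j w := re_tr (comm (comm (B (X w)) (plane_gen R i j)) (plane_gen R i j)) (P w) * S w ^+ m.+1 +
     re_tr (comm (B (X w)) (plane_gen R i j)) (P w) *
       (m.+1%:R * S w ^+ m * re_tr (comm (A (X w)) (plane_gen R i j)) (P w)).
  have bH i j : bounded_rv (H i j).
    apply: (adm_add cl); apply: (adm_mul cl) => //.
    - by apply: (adm_re_tr cl); [do 2 apply: (adm_mx_comm cl); exact: bounded_B|exact: bounded_P].
    - by apply: bcomm; exact: bounded_B.
    - apply: (adm_mul cl); last by apply: bcomm; exact: bounded_A.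
      by apply: (adm_mul cl) => //; exact: (adm_cst cl).
  have H0 i j : 'E (H i j) = 0.
    exact: (stein_rot X_random P_random XP_indep XP_inv mA measurable_B eA equivariant_B bounded_A bounded_B bounded_P).
  transitivity ('E (fun w => \sum_i \sum_j H i j w)).
    congr expect; apply/funext => w; rewrite /H.
    under [RHS]eq_bigr do rewrite big_split /= -mulr_suml.
    rewrite big_split /= -mulr_suml.
    under [X in _ = X * _ + _]eq_bigr do rewrite -re_tr_suml.
    rewrite -re_tr_suml casimir_B re_trNl re_trZl -/(S w).
    have -> : \sum_i \sum_j re_tr (comm (B (X w)) (plane_gen R i j)) (P w) *
       (m.+1%:R * S w ^+ m * re_tr (comm (A (X w)) (plane_gen R i j)) (P w)) =
       m.+1%:R * S w ^+ m * G w.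
      rewrite /G mulr_sumr; apply: eq_bigr => i _.
      rewrite mulr_sumr; apply: eq_bigr => j _; exact: mulrCA.
    by rewrite (exprS _ m.+1) mulNr !mulrA addrC.
  rewrite expect_sum => [|i]; last by apply: (adm_sum cl).
  by apply: big1 => i _; rewrite expect_sum // big1.
move: id; rewrite expectB; [|by apply: (adm_mul cl); [exact: (adm_cst cl)|exact: (adm_mul cl)]
  |by apply: (adm_mul cl) => //; exact: (adm_cst cl)].
rewrite !expectZ //; last by apply: (adm_mul cl).
move=> /eqP; rewrite subr_eq0 => /eqP id.
have hG : 'E (fun w => S w ^+ m * G w) <= 'E (fun w => (16 * n.+1%:R * theta ^+ 2 * c) * S w ^+ m).
  apply: expect_le; [exact: (adm_mul cl)|by apply: (adm_mul cl) => //; exact: (adm_cst cl)|].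
  by move=> w; rewrite mulrC ler_wpM2r ?exprn_even_ge0 // cross_bound.
rewrite expectZ // in hG.
have N0 : 0 < 4 * (n%:R + 1) :> R by rewrite mulr_gt0 // ltr_wpDl.
rewrite -(ler_pM2l N0).
have -> : 4 * (n%:R + 1) * ((n%:R - 1) * 'E (fun w => S w ^+ m.+2)) =
   4 * (n%:R ^+ 2 - 1) * 'E (fun w => S w ^+ m.+2) by ring.
rewrite -id; apply: (@le_trans _ _ (m.+1%:R * (16 * n.+1%:R * theta ^+ 2 * c * 'E (fun w => S w ^+ m)))).
  by rewrite ler_wpM2l.
by rewrite -(natr1 n) le_eqVlt; apply/orP; left; apply/eqP; ring.
Qed.

Lemma fourth_moment : (2 <= n)%N ->
  'E (fun w => S w ^+ 4) <= 48 * (theta ^+ 2 * c) ^+ 2 / (n%:R - 1) ^+ 2.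
Proof.
move=> n2.
have k0 : 0 < n%:R - 1 :> R by rewrite subr_gt0 ltr1n.
have h2 := @moment_step 0 isT n2; have h4 := @moment_step 2 isT n2.
have e0 : 'E (fun w => S w ^+ 0) = 1 by under eq_fun do rewrite expr0; exact: expect_cst.
have c0 : 0 <= theta ^+ 2 * c.
  rewrite mulr_ge0 ?sqr_ge0 //.
  have [w0] := probability_inhabited Pr.
  have [v [nv _]] := P_rank1 w0.
  by have := A_norm w0 v; rewrite nv mulr1; apply: le_trans; exact: norm2_ge0.
rewrite e0 in h2; rewrite ler_pdivlMr ?exprn_gt0 //.
move: h2 h4 k0 c0; set a := 'E _; set b := 'E _; set k := n%:R - 1.
move=> h2 h4 k0 c0.
have h2' : k * a <= 4 * (theta ^+ 2 * c) by apply: le_trans h2 _; lra.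
have h4' : k * b <= 12 * (theta ^+ 2 * c) * a by apply: le_trans h4 _; lra.
move: (theta ^+ 2 * c) c0 h2' h4' => t t0 h2' h4'.
have h1 : k * (k * b) <= k * (12 * t * a) by rewrite ler_pM2l.
have h3 : t * (k * a) <= t * (4 * t) by exact: ler_wpM2l.
rewrite expr2 mulrC -mulrA; apply: le_trans h1 _; rewrite expr2; lra.
Qed.
End moments.

(** * From fourth moments to almost sure convergence *)

Section almost_sure.
Context (d : measure_display) (T : measurableType d) (R : realType).
Variable Pr : probability T R.

Lemma sum_inv_sqr (m : nat) : \sum_(0 <= k < m) ((k.+1%:R : R) ^+ 2)^-1 <= 2.
Proof.
case: m => [|m]; first by rewrite big_geq.
suff h : \sum_(0 <= k < m.+1) ((k.+1%:R : R) ^+ 2)^-1 <= 2 - m.+1%:R^-1.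
  by apply: le_trans h _; rewrite gerBl.
elim: m => [|m IH]; first by rewrite big_nat1 expr1n invr1; lra.
rewrite big_nat_recr //=; apply: le_trans (lerD IH (lexx _)) _.
have a0 : 0 < m.+1%:R :> R by rewrite ltr0n.
rewrite -[m.+2%:R]natr1; move: (m.+1%:R) a0 => x x0.
have x1 : 0 < x + 1 by lra.
rewrite -subr_ge0 (_ : _ - _ = (x * (x + 1) ^+ 2)^-1); last by field; rewrite !gt_eqF.
by rewrite invr_ge0 mulr_ge0 ?sqr_ge0 // ltW.
Qed.

(** The sum of the fourth powers has finite expectation, so it is finite almost
    surely and its terms tend to 0. *)
Lemma ae_cvg0 (S : nat -> T -> R) (K : R) :
  (forall n, bounded_rv (S n)) ->
  (forall n, (2 <= n)%N -> expect Pr (fun w => S n w ^+ 4) <= K / (n%:R - 1) ^+ 2) ->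
  {ae Pr, forall w, S n w @[n --> \oo] --> (0 : R)}.
Proof.
move=> bS hS.
pose f n w : \bar R := (S n.+2 w ^+ 4)%:E.
have b4 n : bounded_rv (fun w => S n w ^+ 4) by apply: (adm_exp (@bounded_rv_closed _ _ _)).
have f0 n w : (0 <= f n w)%E by rewrite lee_fin exprn_even_ge0.
have mf n : measurable_fun setT (f n) by apply: measurableT_comp => //; case: (b4 n.+2).
have If n : (\int[Pr]_w f n w <= (K / n.+1%:R ^+ 2)%:E)%E.
  have := hS n.+2 isT; rewrite /expect /Rintegral -lee_fin fineK; last first.
    by apply: integrable_fin_num => //; exact: bounded_rv_integrable.
  by rewrite -(natr1 n.+1) addrK.
have K0 : 0 <= K.
  have := le_trans (integral_ge0 _ (fun w _ => f0 0%N w)) (If 0%N).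
  by rewrite lee_fin expr1n divr1; apply.
have Ifin : (\int[Pr]_w (\sum_(n <oo) f n w) < +oo)%E.
  rewrite integral_nneseries //.
  apply: (@le_lt_trans _ _ (2 * K)%:E); last exact: ltry.
  apply: lime_le; first by apply: is_cvg_nneseries => n _ _; exact: integral_ge0.
  apply: nearW => m.
  apply: (@le_trans _ _ (\sum_(0 <= k < m) (K / k.+1%:R ^+ 2)%:E)%E).
    by apply: lee_sum => k _; exact: If.
  by rewrite sumEFin lee_fin -mulr_sumr mulrC ler_wpM2r // sum_inv_sqr.
have ms : measurable_fun setT (fun w => \sum_(n <oo) f n w)%E.
  by apply: ge0_emeasurable_sum.
have iF : Pr.-integrable setT (fun w => \sum_(n <oo) f n w)%E.
  apply/integrableP; split => //.
  apply: le_lt_trans Ifin; rewrite le_eqVlt; apply/orP; left; apply/eqP.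
  by apply: eq_integral => w _; rewrite gee0_abs // nneseries_ge0.
have := integrable_ae measurableT iF.
apply: filterS => w /(_ I) fw.
set L := fine (\sum_(n <oo) f n w)%E.
have part m : series (fun n => S n.+2 w ^+ 4) m <= L.
  rewrite -lee_fin /L fineK // /series /= -sumEFin.
  by apply: nneseries_lim_ge => n _ _; exact: f0.
have cs : cvgn (series (fun n => S n.+2 w ^+ 4)).
  apply: nondecreasing_is_cvgn.
    by apply/nondecreasing_series => n _ _; rewrite exprn_even_ge0.
  by exists L => _ [m _ <-].
have c4 := cvg_series_cvg_0 cs.
apply/cvgr0Pnorm_le => e e0.
have e4 : 0 < e ^+ 4 by rewrite exprn_gt0.
have /cvgr0Pnorm_le /(_ _ e4) h4 := c4.
have : \forall n \near \oo, `|S n.+2 w| <= e.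
  apply: filterS h4 => n; rewrite ger0_norm ?exprn_even_ge0 // => h.
  rewrite -(ler_pXn2r (_ : (0 < 4)%N)) ?nnegrE ?(ltW e0) //.
  by rewrite -normrX ger0_norm ?exprn_even_ge0.
move=> [N _ hN]; exists N.+2 => // n /= Nn.
have := hN (n - 2)%N; rewrite /= leq_subRL; last by apply: leq_trans Nn.
by rewrite addSn addSn add0n => /(_ Nn); rewrite -addn2 subnK //; apply: leq_trans Nn.
Qed.
End almost_sure.

(** * Truncated powers *)

Section truncated_power.
Variables (R : realType) (n k : nat) (b : R).
Local Notation C := R[i].
Local Notation M := 'M[C]_n.+1.
Local Notation Mx := (mxspace R n.+1).

(** A bound on the spectral radius by a trace: it is polynomial, hence measurable,
    and invariant under conjugation. An exponent of the order of the dimension costs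
    at most a factor 2 in the bound, see [ev_small_spectrum]. *)
Definition small_spectrum (x : M) : bool :=
  complex.Re (\tr (x ^+ (2 * n.+1))) <= b ^+ (2 * n.+1).

Definition centered_power (x : M) : M := x ^+ k - (n.+1%:R^-1 * \tr (x ^+ k))%:M.

Definition trunc_power (x : M) : M := ((small_spectrum x)%:R : R)%:C *: centered_power x.

Hypothesis b0 : 0 < b.

Lemma measurable_mx_trunc_power : measurable_mx (trunc_power : Mx -> M).
Proof.
have cM := measurable_closed R Mx.
have mpow q : measurable_mx (fun x : Mx => (x : M) ^+ q) by apply: (adm_mx_exp cM); exact: measurable_mx_id.
apply: (adm_mx_scale cM).
  apply: (adm_cplx_real cM).
  have [h _] := adm_cplx_tr cM (mpow (2 * n.+1)%N).
  have hb : measurable_fun setT (fun x : Mx => complex.Re (\tr ((x : M) ^+ (2 * n.+1))) <= b ^+ (2 * n.+1)).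
    by apply: measurable_fun_ler => //; exact: measurable_cst.
  rewrite (_ : (fun x => _) = fun x : Mx => if small_spectrum x then 1 else 0); last first.
    by apply/funext => x; case: small_spectrum.
  by apply: measurable_fun_ifT => //; exact: measurable_cst.
apply: (adm_mx_sub cM); first exact: mpow.
apply: (@adm_mx_scalar _ _ _ cM n.+1 (fun x : Mx => n.+1%:R^-1 * \tr ((x : M) ^+ k))).
by apply: (adm_cplx_mul cM); [exact: (adm_cplx_cst cM)|exact: (adm_cplx_tr cM (mpow k))].
Qed.

Lemma conj_pow (U x : M) q : U * U^t* = 1 -> U^t* * U = 1 ->
  (U * x * U^t*) ^+ q = U * x ^+ q * U^t*.
Proof.
move=> h1 h2; elim: q => [|q IH]; first by rewrite !expr0 mulr1 h1.
by rewrite !exprS IH -!mulrA (mulrA (U^t*) U) h2 mul1r.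
Qed.

Lemma tr_conj (U x : M) : U^t* * U = 1 -> \tr (U * x * U^t*) = \tr x.
Proof. by move=> h; rewrite -mulmxE mxtrace_mulC mulmxE mulrA h mul1r. Qed.

Lemma trunc_power_equivariant : rot_equivariant trunc_power.
Proof.
move=> i j s x hs U.
have h1 : U * U^t* = 1 by exact: (rot_unitary (plane_gen_adj R i j) (plane_gen_cube R i j)).
have h2 : U^t* * U = 1 by exact: (rot_mulV (plane_gen_adj R i j) (plane_gen_cube R i j)).
rewrite /trunc_power /centered_power /small_spectrum !conj_pow // !tr_conj //.
rewrite -scalerAr -scalerAl; congr (_ *: _); rewrite mulrBr mulrBl; congr (_ - _).
by rewrite -[LHS]scalemx1 -[in RHS]scalemx1 -scalerAr -scalerAl mulr1 h1.
Qed.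

Lemma trunc_power_tr x : \tr (trunc_power x) = 0.
Proof.
rewrite /trunc_power mxtraceZ /centered_power raddfB /= mxtrace_scalar -[(_ * _) *+ _]mulr_natl mulrA.
by rewrite divff ?mul1r ?subrr ?mulr0 // pnatr_eq0.
Qed.

Lemma centered_powerE x : x \is hermsymmx ->
  centered_power x = x ^+ k - (n.+1%:R^-1 * \sum_j ev x j ^+ k)%:C%:M.
Proof.
move=> hx; rewrite /centered_power tr_pow //; congr (_ - _%:M).
by rewrite rmorphM fmorphV (rmorph_nat (real_complex R)).
Qed.

Lemma trunc_power_herm x : x \is hermsymmx -> (trunc_power x)^t* = trunc_power x.
Proof.
move=> hx; rewrite /trunc_power adjZ centered_powerE //; congr (_ *: _).
rewrite adjD herm_pow //; congr (_ + _); apply/matrixP => i j.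
by rewrite !mxE rmorphN rmorphMn /= conjR eq_sym.
Qed.

Lemma small_spectrum_ev x j : x \is hermsymmx -> small_spectrum x -> `|ev x j| <= b.
Proof.
move=> hx; rewrite /small_spectrum tr_pow //= => h.
rewrite -(ler_pXn2r (_ : (0 < 2 * n.+1)%N)) ?nnegrE ?(ltW b0) //.
apply: le_trans h; rewrite -normrX ger0_norm; last by rewrite exprM exprn_ge0 // sqr_ge0.
rewrite (bigD1 j) //= lerDl sumr_ge0 // => i _.
by rewrite exprM exprn_ge0 // sqr_ge0.
Qed.

Lemma ev_small_spectrum x : x \is hermsymmx -> (forall j, `|ev x j| <= b / 2) -> small_spectrum x.
Proof.
move=> hx h; rewrite /small_spectrum tr_pow //=.
apply: (@le_trans _ _ (\sum_(j < n.+1) (b / 2) ^+ (2 * n.+1))).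
  apply: ler_sum => j _; rewrite -[leLHS]ger0_norm; last by rewrite exprM exprn_ge0 // sqr_ge0.
  by rewrite normrX lerXn2r ?nnegrE // divr_ge0 // ltW.
rewrite sumr_const card_ord -[leLHS]mulr_natr exprMn exprVn -mulrA ger_pMr ?exprn_gt0 //.
rewrite ler_pdivrMl ?exprn_gt0 // mulr1 -natrX ler_nat.
apply: ltnW; apply: leq_trans (ltn_expl _ (ltnSn 1)) _.
by rewrite leq_exp2l // leq_pmull.
Qed.

Lemma trunc_power_norm x y : x \is hermsymmx ->
  norm2 (y *m trunc_power x) <= 4 * b ^+ (2 * k) * norm2 y.
Proof.
move=> hx; have c0 : 0 <= 4 * b ^+ (2 * k) * norm2 y.
  by rewrite !mulr_ge0 ?norm2_ge0 // exprn_ge0 // ltW.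
rewrite /trunc_power; case: (boolP (small_spectrum x)) => hs; last first.
  by rewrite scale0r mulmx0 (_ : norm2 _ = 0) // /norm2 big1 // => i _; rewrite mxE /sqmod /= expr0n addr0.
rewrite scale1r centered_powerE // mulmxBr mul_mx_scalar.
have evb j : `|ev x j| <= b by exact: small_spectrum_ev.
set t := _ * \sum_j _.
have bk0 : 0 <= b ^+ k by rewrite exprn_ge0 // ltW.
have pw j : `|ev x j ^+ k| <= b ^+ k by rewrite normrX lerXn2r ?nnegrE // ltW.
have tb : t ^+ 2 <= b ^+ (2 * k).
  rewrite mulnC exprM -[leLHS]ger0_norm ?sqr_ge0 // normrX lerXn2r ?nnegrE //.
  rewrite /t normrM normfV normr_nat ler_pdivrMl ?ltr0n //.
  apply: le_trans (ler_norm_sum _ _ _) _.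
  apply: le_trans (ler_sum _ (fun j _ => pw j)) _.
  by rewrite sumr_const card_ord -[leLHS]mulr_natl.
have hp : norm2 (y *m x ^+ k) <= b ^+ (2 * k) * norm2 y.
  rewrite norm2_pow // -(sum_wt x y) mulr_sumr; apply: ler_sum => j _.
  rewrite mulrC ler_wpM2r ?wt_ge0 // mulnC !exprM -[leLHS]ger0_norm ?sqr_ge0 //.
  by rewrite normrX lerXn2r ?nnegrE.
apply: (@le_trans _ _ (2 * (norm2 (y *m x ^+ k) + t ^+ 2 * norm2 y))).
  rewrite -sqmodR -norm2Z /norm2 -big_split mulr_sumr; apply: ler_sum => i _.
  by rewrite !mxE /=; exact: sqmodD_le.
have := ler_wpM2r (norm2_ge0 y) tb; lra.
Qed.

Lemma re_tr_trunc_power x (v : 'rV[C]_n.+1) (theta : R) : x \is hermsymmx -> norm2 v = 1 ->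
  (forall j, `|ev x j| <= b / 2) ->
  re_tr (trunc_power x) (theta%:C *: (v^t* *m v)) =
  theta * \sum_j (wt x v j - n.+1%:R^-1) * ev x j ^+ k.
Proof.
move=> hx nv /(ev_small_spectrum hx) hs.
rewrite /re_tr tr_rank1 ReZ /trunc_power hs scale1r centered_powerE //; congr (_ * _).
rewrite mulmxBr mulmxBl mxE quad_pow // mul_mx_scalar -scalemxAl [X in _ + X]mxE.
rewrite [X in - X]mxE norm2E nv mulr1 -rmorphB /= mulr_sumr -sumrB.
by apply: eq_bigr => j _; rewrite mulrBl.
Qed.
End truncated_power.

Section overlap_moments.
Context (d : measure_display) (T : measurableType d) (R : realType).
Variable Pr : probability T R.
Local Notation C := R[i].
Variables (s : symmetry_class) (X P : forall n : nat, T -> 'M[C]_n.+1) (theta b : R).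
Hypothesis X_random : forall n, random_matrix (X n).
Hypothesis P_random : forall n, random_matrix (P n).
Hypothesis XP_indep : forall n, independent_matrices Pr (X n) (P n).
Hypothesis XP_inv : forall n, conj_invariant Pr s (X n) \/ conj_invariant Pr s (P n).
Hypothesis X_herm : forall n w, X n w \is hermsymmx.
Hypothesis P_rank1 : forall n w, exists v : 'rV[C]_n.+1,
  norm2 v = 1 /\ P n w = theta%:C *: (v^t* *m v).
Hypothesis b0 : 0 < b.

(** Truncation makes the moment bounds deterministic; once the spectrum is eventually
    bounded it has no effect. *)
Lemma trunc_power_ae : {ae Pr, forall w, forall k,
  re_tr (trunc_power k b (X n w)) (P n w) @[n --> \oo] --> (0 : R)}.
Proof.
apply/ae_foralln => k.
have mX n : measurable_mx (X n) by apply/measurable_mxP/random_matrixP.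
apply: (@ae_cvg0 _ _ _ _ _ (48 * (theta ^+ 2 * (4 * b ^+ (2 * k))) ^+ 2)).
  move=> n; apply: bounded_form => //.
  - exact: measurable_mx_trunc_power.
  - by move=> w y; exact: trunc_power_norm.
move=> n n2; apply: (@fourth_moment _ _ _ _ _ s) => //.
- exact: measurable_mx_trunc_power.
- exact: trunc_power_equivariant.
- by move=> w; exact: trunc_power_tr.
- by move=> w; exact: trunc_power_herm.
- by move=> w y; exact: trunc_power_norm.
Qed.
End overlap_moments.

(** * The overlap tends to zero *)

Section overlap.
Variable R : realType.
Local Notation C := R[i].
Variable mu : probability (measurableTypeR R) R.
Variables (a b theta : R).
Variables (X : forall n : nat, 'M[C]_n.+1) (u v : forall n : nat, 'rV[C]_n.+1).
Hypothesis X_herm : forall n, X n \is hermsymmx.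
Hypothesis X_spectrum : weak_cvg (fun n => empirical_measure (X n)) mu.
Hypothesis X_min : lambda_min (X n) @[n --> \oo] --> a.
Hypothesis X_max : lambda_max (X n) @[n --> \oo] --> b.
Hypothesis theta_neq0 : theta != 0.
Hypothesis v_unit : forall n, norm2 (v n) = 1.
Hypothesis u_unit : forall n, norm2 (u n) = 1.
Hypothesis overlap_moments : forall k,
  (fun n => \sum_j (wt (X n) (v n) j - n.+1%:R^-1) * ev (X n) j ^+ k) @ \oo --> (0 : R).

Let P n : 'M[C]_n.+1 := theta%:C *: ((v n)^t* *m v n).
Let G := cauchy_transform mu.
Let l (n : nat) (j : 'I_n.+1) : R := ev (X n) j.
Let w (n : nat) (j : 'I_n.+1) : R := wt (X n) (v n) j.
Arguments l : clear implicits.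
Arguments w : clear implicits.

Lemma ev_upper e : 0 < e -> \forall n \near \oo, forall j, l n j <= b + e.
Proof.
move=> e0; have be : b < b + e by rewrite ltrDl.
have : \forall n \near \oo, lambda_max (X n) <= b + e by exact: (cvgr_le _ X_max _ be).
apply: filterS => n h j.
exact: le_trans (ev_le_max _ _) h.
Qed.

Lemma ev_lower e : 0 < e -> \forall n \near \oo, forall j, - l n j <= - a + e.
Proof.
move=> e0; have ae : a - e < a by rewrite ltrBlDr ltrDl.
have : \forall n \near \oo, a - e <= lambda_min (X n) by exact: (cvgr_ge _ X_min _ ae).
apply: filterS => n h j.
by have := ev_ge_min (X n) j; rewrite /l; lra.
Qed.

Lemma sum_w n : \sum_j w n j = 1.
Proof. by rewrite /w sum_wt v_unit. Qed.

(** The spectral measures of [X n] at [v n] have the same limit as the empirical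
    ones, because their moments differ by sequences that tend to 0. *)
Lemma overlap_stieltjes (s z d m r : R) : s ^+ 2 = 1 -> 0 < d ->
  (\forall n \near \oo, forall j, d <= s * (z - l n j)) ->
  (\forall n \near \oo, forall j, `|l n j - m| <= r) -> r < `|z - m| ->
  (fun n => \sum_j w n j / (z - l n j)) @ \oo --> G z.
Proof.
move=> s1 d0 hd hr rz.
have c1 := empirical_cauchy X_spectrum s1 d0 hd.
have r0 : 0 <= r.
  by have [n /(_ ord0)] := filter_ex hr; apply: le_trans.
have c2 : (fun n => \sum_j (w n j - n.+1%:R^-1) / (z - l n j)) @ \oo --> (0 : R).
  apply: (@stieltjes_transfer _ (fun n j => w n j - n.+1%:R^-1) l m r z) => // n.
  apply: (@le_trans _ _ (\sum_(j < n.+1) (w n j + n.+1%:R^-1))).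
    apply: ler_sum => j _; apply: le_trans (ler_normB _ _) _.
    by rewrite ger0_norm ?wt_ge0 // ger0_norm // invr_ge0.
  rewrite big_split /= sum_w sumr_const card_ord -[X in _ + X]mulr_natl divff //.
have : ((fun n => \sum_j (w n j - n.+1%:R^-1) / (z - l n j)) +
    (fun n => \sum_j n.+1%:R^-1 / (z - ev (X n) j))) @ \oo --> 0 + G z by exact: cvgD.
rewrite add0r; apply: cvg_trans; apply: near_eq_cvg; apply: nearW => n.
rewrite fctE -big_split /=; apply: eq_bigr => j _.
by rewrite -mulrDl subrK.
Qed.

Lemma stieltjes_above z : b < z -> (fun n => \sum_j w n j / (z - l n j)) @ \oo --> G z.
Proof.
move=> bz; pose d := (z - b) / 2.
have d0 : 0 < d by rewrite divr_gt0 // subr_gt0.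
have e1 : \forall n \near \oo, forall j, l n j <= b + d by exact: ev_upper.
have e2 : \forall n \near \oo, forall j, - l n j <= - a + 1 by exact: ev_lower.
have dz : b + d = z - d by rewrite /d; field.
apply: (@overlap_stieltjes 1 z d (a - 1) (b + d - (a - 1))) => //.
- by rewrite expr1n.
- by move: e1; apply: filterS => n h j; have := h j; rewrite mul1r; lra.
- near=> n.
  have h1 : forall j, l n j <= b + d by near: n.
  have h2 : forall j, - l n j <= - a + 1 by near: n.
  by move=> j; have := h1 j; have := h2 j; rewrite ler_norml => ? ?; apply/andP; split; lra.
- by apply: lt_le_trans (ler_norm _); lra.
Unshelve. all: by end_near.
Qed.

Lemma stieltjes_below z : z < a -> (fun n => \sum_j w n j / (z - l n j)) @ \oo --> G z.
Proof.
move=> az; pose d := (a - z) / 2.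
have d0 : 0 < d by rewrite divr_gt0 // subr_gt0.
have e1 : \forall n \near \oo, forall j, l n j <= b + 1 by exact: ev_upper.
have e2 : \forall n \near \oo, forall j, - l n j <= - a + d by exact: ev_lower.
have dz : a - d = z + d by rewrite /d; field.
apply: (@overlap_stieltjes (-1) z d (b + 1) (b + 1 - a + d)) => //.
- by rewrite sqrrN expr1n.
- by move: e2; apply: filterS => n h j; have := h j; lra.
- near=> n.
  have h1 : forall j, l n j <= b + 1 by near: n.
  have h2 : forall j, - l n j <= - a + d by near: n.
  by move=> j; have := h1 j; have := h2 j; rewrite ler_norml => ? ?; apply/andP; split; lra.
- by rewrite distrC; apply: lt_le_trans (ler_norm _); lra.
Unshelve. all: by end_near.
Qed.

Lemma stieltjes_reflected z : - a < z ->
  (fun n => \sum_j w n j / (z - - l n j)) @ \oo --> - G (- z).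
Proof.
move=> az; have h : - z < a by rewrite ltrNl.
have : - (fun n => \sum_j w n j / (- z - l n j)) @ \oo --> - G (- z).
  by apply: cvgN; exact: stieltjes_below.
apply: cvg_trans; apply: near_eq_cvg; apply: nearW => n.
rewrite fctE -sumrN; apply: eq_bigr => j _.
by rewrite -mulrN -invrN; congr (_ * _^-1); ring.
Qed.

Hypothesis subcritical :
  ~ (left_lim G a < (theta^-1)%:E < right_lim G b)%E.
Hypothesis G'_b : 0 < theta -> right_lim (derive1 G) b = -oo%E.
Hypothesis G'_a : theta < 0 -> left_lim (derive1 G) a = -oo%E.
Hypothesis u_eigenvector : forall n, u n *m (X n + P n) =
  (if 0 < theta then lambda_max (X n + P n) else lambda_min (X n + P n))%:C *: u n.

Let q n := sqmod ((u n *m (v n)^t*) 0 0).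

Lemma w_ge0 n j : 0 <= w n j. Proof. exact: wt_ge0. Qed.

Lemma XP_herm n : X n + P n \is hermsymmx.
Proof.
apply: herm_intro; rewrite adjD adjZ (hermP (X_herm n)).
by rewrite trmx_mul map_mxM trmxCK.
Qed.

(** A negative [theta] is treated by reflecting the real line: the points [- l n j],
    the function [z |-> - G (- z)] and [- theta] satisfy the hypotheses of the positive
    case at the edge [- a]. *)
Lemma overlap_cvg0 : q @ \oo --> (0 : R).
Proof.
have G_ge0 := stieltjes_ge0 w_ge0 ev_upper stieltjes_above.
have N_ge0 := stieltjes_ge0 w_ge0 ev_lower stieltjes_reflected.
have q_ge0 n : 0 <= q n by exact: sqmod_ge0.
have q_neq0 n : q n != 0 -> (u n *m (v n)^t*) 0 0 != 0.
  by apply: contraNneq; rewrite /q => ->; rewrite /sqmod /= expr0n addr0.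
have [th|th] := ltP 0 theta.
  have lo : \forall n \near \oo, forall j, a - 1 <= l n j.
    by move: (ev_lower ltr01); apply: filterS => n h j; have := h j; lra.
  have Gd := stieltjes_strict w_ge0 sum_w ev_upper lo stieltjes_above.
  apply: (subcritical_core w_ge0 ev_upper stieltjes_above th) => //.
  - move=> z bz; rewrite -lte_fin; apply: lt_le_trans (lt_right_lim Gd bz) _.
    rewrite leNgt; apply/negP => h; apply: subcritical; rewrite h andbT.
    apply: le_lt_trans (left_lim_le0 N_ge0) _.
    by rewrite lte_fin invr_gt0.
  - exact: quot_right (G'_b th).
  - move=> n /q_neq0 qn.
    have := u_eigenvector n; rewrite th => hu.
    have [h1 h2 h3] := secular (X_herm n) (u_unit n) theta_neq0 hu qn.
    split; [|exact: h2|exact: h3].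
    move=> j wj; rewrite lt_neqAle h1 //=.
    exact: lambda_max_rank1 (X_herm n) (XP_herm n) th.
have {}th : theta < 0 by rewrite lt_neqAle theta_neq0.
have tF : (0 < theta) = false by rewrite lt_gtF.
have lo : \forall n \near \oo, forall j, - b - 1 <= - l n j.
  by move: (ev_upper ltr01); apply: filterS => n h j; have := h j; lra.
have Gd := stieltjes_strict w_ge0 sum_w ev_lower lo stieltjes_reflected.
have thN : 0 < - theta by rewrite oppr_gt0.
apply: (@subcritical_core _ (fun z => - G (- z)) (- a) (- theta) (fun n j => - l n j) w
  (fun n => - lambda_min (X n + P n)) q w_ge0 ev_lower stieltjes_reflected thN) => //.
- move=> z az; rewrite invrN ltrN2 -lte_fin.
  apply: le_lt_trans (left_lim_lt Gd az).
  rewrite leNgt; apply/negP => h; apply: subcritical; rewrite h /=.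
  apply: lt_le_trans (right_lim_ge0 G_ge0).
  by rewrite lte_fin invr_lt0.
- exact: quot_left (G'_a th).
- move=> n /q_neq0 qn.
  have := u_eigenvector n; rewrite tF => hu.
  have [h1 h2 h3] := secular (X_herm n) (u_unit n) theta_neq0 hu qn.
  have e j : - lambda_min (X n + P n) - - l n j = - (lambda_min (X n + P n) - l n j).
    by rewrite opprB opprK addrC.
  split.
  + move=> j wj; rewrite ltrN2 lt_neqAle eq_sym h1 //=.
    exact: lambda_min_rank1 (X_herm n) (XP_herm n) th.
  + rewrite invrN -h2 -sumrN; apply: eq_bigr => j _.
    by rewrite e invrN mulrN.
  + rewrite sqrrN; apply: le_trans h3; rewrite le_eqVlt; apply/orP; left; apply/eqP.
    by congr (_ * _); apply: eq_bigr => j _; rewrite e sqrrN.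
Qed.

Lemma proj_norm_cvg0 :
  proj_norm (u n) (kermx ((theta%:C)%:M - P n)) @[n --> \oo] --> (0 : R).
Proof.
under eq_fun do rewrite proj_normE //.
apply/cvgr0Pnorm_le => e e0; have e2 : 0 < e ^+ 2 by rewrite exprn_gt0.
have /cvgr0Pnorm_le /(_ _ e2) := overlap_cvg0; apply: filterS => n.
rewrite ger0_norm ?sqmod_ge0 // => h; rewrite ger0_norm ?sqrtr_ge0 //.
by rewrite -[e]ger0_norm ?(ltW e0) // -sqrtr_sqr ler_wsqrtr.
Qed.
End overlap.

Theorem theorem2p3 (d : measure_display) (T : measurableType d) (R : realType)
    (Pr : probability T R) (s : symmetry_class)
    (X P : forall n : nat, T -> 'M[R[i]]_n.+1)
    (mu : probability (measurableTypeR R) R) (a b theta : R)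
    (u : forall n : nat, T -> 'rV[R[i]]_n.+1)
    (X_random : forall n, random_matrix (X n))
    (X_self_adjoint : forall n w, self_adjoint s (X n w))
    (X_spectrum : {ae Pr, forall w,
      weak_cvg (fun n => empirical_measure (X n w)) mu})
    (mu_compact : compact (msupport mu))
    (a_inf : a = inf (msupport mu))
    (b_sup : b = sup (msupport mu))
    (X_min : {ae Pr, forall w, lambda_min (X n w) @[n --> \oo] --> a})
    (X_max : {ae Pr, forall w, lambda_max (X n w) @[n --> \oo] --> b})
    (theta_neq0 : theta != 0)
    (P_random : forall n, random_matrix (P n))
    (P_self_adjoint : forall n w, self_adjoint s (P n w))
    (P_rank1 : forall n w, \rank (P n w) = 1%N)
    (P_eigenvalue : forall n w (z : R[i]), z != 0 ->
      eigenvalue (P n w) z = (z == theta%:C))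
    (XP_independent : forall n, independent_matrices Pr (X n) (P n))
    (XP_invariant : forall n,
      conj_invariant Pr s (X n) \/ conj_invariant Pr s (P n))
    (theta_subcritical :
      ~ (left_lim (cauchy_transform mu) a < (theta^-1)%:E
           < right_lim (cauchy_transform mu) b)%E)
    (G'_b : 0 < theta -> right_lim (derive1 (cauchy_transform mu)) b = -oo%E)
    (G'_a : theta < 0 -> left_lim (derive1 (cauchy_transform mu)) a = -oo%E)
    (u_over : forall n w, over_scalars s (u n w))
    (u_unit : forall n w, vnorm (u n w) = 1)
    (u_eigenvector : forall n w,
      u n w *m (X n w + P n w) =
        (if 0 < theta then lambda_max (X n w + P n w)
         else lambda_min (X n w + P n w))%:C *: u n w) :
  {ae Pr, forall w,
    proj_norm (u n w) (kermx ((theta%:C)%:M - P n w)) @[n --> \oo] --> (0 : R)}.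
Proof.
have X_herm n w : X n w \is hermsymmx by case: (X_self_adjoint n w).
have P_dyad n w : exists v : 'rV[R[i]]_n.+1,
    norm2 v = 1 /\ P n w = theta%:C *: (v^t* *m v).
  apply: rank1_herm => //; first by case: (P_self_adjoint n w).
  by rewrite P_eigenvalue ?eqxx // (inj_eq (@complexI R) _ 0).
(* the factor 2 is the loss in [ev_small_spectrum] *)
pose B := 2 * (`|a| + `|b| + 1).
have B0 : 0 < B by rewrite mulr_gt0 // ltr_wpDl // addr_ge0.
have S0 := trunc_power_ae X_random P_random XP_independent XP_invariant X_herm P_dyad B0.
near=> w.
have wS : weak_cvg (fun n => empirical_measure (X n w)) mu by near: w.
have wmin : lambda_min (X n w) @[n --> \oo] --> a by near: w.
have wmax : lambda_max (X n w) @[n --> \oo] --> b by near: w.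
have wM : forall k, re_tr (trunc_power k B (X n w)) (P n w) @[n --> \oo] --> (0 : R) by near: w.
pose v n := projT1 (cid (P_dyad n w)).
have hv n : norm2 (v n) = 1 /\ P n w = theta%:C *: ((v n)^t* *m v n) := projT2 (cid (P_dyad n w)).
have v_unit n : norm2 (v n) = 1 by case: (hv n).
have Pv n : P n w = theta%:C *: ((v n)^t* *m v n) by case: (hv n).
have u1 n : norm2 (u n w) = 1.
  have := u_unit n w; rewrite vnormE => h.
  by rewrite -(sqr_sqrtr (norm2_ge0 (u n w))) h expr1n.
have small : \forall n \near \oo, forall j, `|ev (X n w) j| <= B / 2.
  near=> n.
  have h1' : forall j, ev (X n w) j <= b + 1 by near: n; exact: (ev_upper wmax ltr01).
  have h2' : forall j, - ev (X n w) j <= - a + 1 by near: n; exact: (ev_lower wmin ltr01).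
  move=> j; have h1 := h1' j; have h2 := h2' j.
  have -> : B / 2 = `|a| + `|b| + 1 by rewrite /B; field.
  have := ler_norm b; have := ler_norm (- a); rewrite normrN => h3 h4.
  have := normr_ge0 a; have := normr_ge0 b => h5 h6.
  by rewrite ler_norml; apply/andP; split; lra.
have moments k : (fun n => \sum_j (wt (X n w) (v n) j - n.+1%:R^-1) * ev (X n w) j ^+ k)
    @ \oo --> (0 : R).
  have : theta^-1 * re_tr (trunc_power k B (X n w)) (P n w) @[n --> \oo] --> theta^-1 * 0.
    by apply: cvgMl_tmp; exact: wM.
  rewrite mulr0; apply: cvg_trans; apply: near_eq_cvg; near=> n.
  rewrite Pv re_tr_trunc_power //; first by rewrite mulrA mulVf // mul1r.
  by near: n.
under eq_fun do rewrite Pv.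
apply: (proj_norm_cvg0 (X_herm ^~ w) wS wmin wmax theta_neq0 v_unit u1 moments
  theta_subcritical G'_b G'_a) => n.
by rewrite -Pv.
Unshelve. all: by end_near.
Qed.
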